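(* Let $\Sigma$ be a connected $(X,2)$-arc-transitive graph of valency $4$, where $X$ acts faithfully on $V(\Sigma)$. Then $\Sigma$ has a self-paired $X$-orbit on $Arc_3(\Sigma)$. Let $\Delta$ be such an orbit, and set $\gimel=\gimel(\Sigma,\Delta)$, $\Xi=\Xi(\Sigma,\Delta)$, $e=|E(\Sigma)|$, $\mu=|V(\Sigma)|$. Let $(\tau,\sigma)\in Arc(\Sigma)$. Then one of the following holds. (a) $\gimel[P_\tau,P_\sigma]\cong\Xi[A_\tau,A_\sigma]\cong 3K_2$, $\gimel\cong mC_n$, $val(\Xi)=3$, and there is an $X$-orbit $\mathcal E$ of $n$-cycles of $\Sigma$ with $|\mathcal E|=m$ such that $\Delta=\bigcup_{C\in\mathcal E}Arc_3(C)$ and $X_{[C]}^{[C]}\cong D_{2n}$ for each $C\in\mathcal E$, where $m\ge6$, $n\ge girth(\Sigma)$, $mn=3e=6\mu$. Moreover either $\Sigma\cong K_5$ or $\Sigma$ is a near $n$-gonal graph with respect to $\mathcal E$; and either (a.1) $X_{P_\tau}=X_{A_\tau}=X_\tau\cong A_4$, both $\gimel$ and $\Xi$ are $(X,1)$-arc-regular and $\Sigma$ is $(X,2)$-arc-regular; or (a.2) $X_\tau=X_{P_\tau}=X_{A_\tau}\cong S_4$, $\gimel$ is not $(X,1)$-arc-regular and $\Xi$ is $(X,2)$-arc-regular. (b) $\gimel[P_\tau,P_\sigma]\cong\Xi[A_\tau,A_\sigma]\cong K_{3,3}-3K_2$, $val(\gimel)=4$, $val(\Xi)=6$, $X_{P_\tau}=X_{A_\tau}=X_\tau\cong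 S_4$, and both $\gimel$ and $\Xi$ are connected and $(X,1)$-arc-regular. Further, $\Delta':=Arc_3(\Sigma)\setminus\Delta$ is a self-paired $X$-orbit on $Arc_3(\Sigma)$, and there is an $X$-orbit $\mathcal E$ of $n$-cycles of $\Sigma$ with $|\mathcal E|=m$ such that $\Delta'=\bigcup_{C\in\mathcal E}Arc_3(C)$ and $X_{[C]}^{[C]}\cong D_{2n}$ for each $C\in\mathcal E$, where $m\ge6$, $n\ge girth(\Sigma)\ge3$, $mn=3e=6\mu$. Moreover either $\Sigma\cong K_5$ or $\Sigma$ is a near $n$-gonal graph with respect to $\mathcal E$. (c) $\gimel[P_\tau,P_\sigma]\cong\Xi[A_\tau,A_\sigma]\cong K_{3,3}$, $val(\gimel)=6$, $val(\Xi)=9$, both $\gimel$ and $\Xi$ are connected and $(X,1)$-transitive, and $\Sigma$ is $(X,3)$-arc-transitive.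
   Context: Graphs are finite, simple, undirected; $\Sigma(\tau)$ is a neighbourhood, $val$ the valency, $mC_n$ the disjoint union of $m$ $n$-cycles. An $s$-arc is a sequence $(\alpha_0,\dots,\alpha_s)$ of vertices with consecutive ones adjacent and $\alpha_{i-1}\ne\alpha_{i+1}$; $Arc_s(\Sigma)$ is their set, $Arc=Arc_1$. An $s$-arc with distinct entries identified with its reverse is an $s$-path $[\alpha_0,\dots,\alpha_s]$; $Path_2(\Sigma)$ is the set of $2$-paths. For $X$ acting on $V(\Sigma)$ preserving adjacency: $(X,s)$-arc-transitive (resp. $(X,s)$-arc-regular) means transitive on vertices and transitive (resp. regular) on $s$-arcs; $(X,1)$-transitive means $(X,1)$- but not $(X,2)$-arc-transitive. $\Delta$ is self-paired if closed under reversal. $\gimel(\Sigma,\Delta)$ has vertex set $Path_2(\Sigma)$ and edges $\{[\alpha_0,\alpha_1,\alpha_2],[\alpha_1,\alpha_2,\alpha_3]\}$ for $(\alpha_0,\ldots,\alpha_3)\in\Delta$; $P_\tau$ is the set of $2$-paths with middle vertex $\tau$. The $3$-arc graph $\Xi(\Sigma,\Delta)$ has vertex set $Arc(\Sigma)$, with $(\tau,\tau_1)\sim(\sigma,\sigma_1)$ iff $(\tau_1,\tau,\sigma,\sigma_1)\in\Delta$; $A_\tau=\{(\tau,\sigma'):\sigma'\in\Sigma(\tau)\}$. For a graph $\Gamma$ with $X$-invariant partition and blocks $P,Q$, $\Gamma[P,Q]$ is the bipartite subgraph induced on the vertices of $P$ with a neighbour in $Q$ together with the vertices of $Q$ with a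 neighbour in $P$. $X_S$ is a setwise stabiliser, $X_\tau$ a vertex stabiliser. For a subgraph $C$, $X_{[C]}$ is the subgroup of $X$ mapping $C$ onto itself and $X_{[C]}^{[C]}=X_{[C]}/X_{(V(C))}$; $D_{2n}$ is dihedral of order $2n$. A near $n$-gonal graph is a connected graph of girth at least $4$ with a set $\mathcal E$ of $n$-cycles such that every $2$-arc lies in a unique member of $\mathcal E$. *)

(* Defs.v *)
From mathcomp Require Import all_boot all_fingroup all_solvable.

Set Implicit Arguments.
Unset Strict Implicit.
Unset Printing Implicit Defensive.

Local Open Scope group_scope.

(* A graph lives inside an ambient finite type U: it is a vertex set together
   with a set of edges, each edge being an unordered pair of vertices. The type
   is finite, so that sets of subgraphs (e.g. of cycles) and group actions on
   them are available. The axioms of a simple graph are in [simple_graph]. *)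
Definition graph (U : finType) : Type := ({set U} * {set {set U}})%type.

Section Graphs.
Variable U : finType.
Implicit Types (G H C : graph U) (u v : U) (P Q : {set U}).

Definition vset G : {set U} := G.1.
Definition eset G : {set {set U}} := G.2.

Definition simple_graph G : bool :=
  [forall ed in eset G, (#|ed| == 2) && (ed \subset vset G)].

Definition adj G : rel U := fun u v => (u != v) && ([set u; v] \in eset G).

Definition nbhd G u : {set U} := [set v | adj G u v].

Definition has_valency G k : Prop := {in vset G, forall u, #|nbhd G u| = k}.

Definition connected_graph G : Prop :=
  {in vset G &, forall u v, connect (adj G) u v}.

Definition subgraph C G : bool :=
  [&& simple_graph C, vset C \subset vset G & eset C \subset eset G].

Definition Arc s G : {set s.+1.-tuple U} :=
  [set t : s.+1.-tuple U |
    [&& [forall i : 'I_s.+1, tnth t i \in vset G],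
        [forall i : 'I_s.+1, forall j : 'I_s.+1,
           (j == i.+1 :> nat) ==> adj G (tnth t i) (tnth t j)]
      & [forall i : 'I_s.+1, forall j : 'I_s.+1,
           (j == i.+2 :> nat) ==> (tnth t i != tnth t j)]]].

(* [t] identified with its reverse. *)
Definition path_of n (t : n.-tuple U) : {set n.-tuple U} :=
  [set t; rev_tuple t].

Definition Path s G : {set {set s.+1.-tuple U}} :=
  [set path_of t | t : s.+1.-tuple U in Arc s G & uniq t].

Definition self_paired n (D : {set n.-tuple U}) : Prop :=
  {in D, forall t, rev_tuple t \in D}.

(* The graph written G[P,Q]. *)
Definition between G P Q : graph U :=
  let P' := [set u in P | [exists v in Q, adj G u v]] in
  let Q' := [set v in Q | [exists u in P, adj G v u]] in
  (P' :|: Q',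
   [set ed in eset G | [exists u in P', exists v in Q', ed == [set u; v]]]).

End Graphs.

Definition isomorphic (U W : finType) (G : graph U) (H : graph W) : bool :=
  [exists f : {ffun U -> W},
    [&& dinjectiveb f (vset G), f @: vset G == vset H
      & [forall u in vset G, forall v in vset G,
           adj H (f u) (f v) == adj G u v]]].

Definition graph_of_rel (U : finType) (r : rel U) : graph U :=
  ([set: U], [set ed | [exists u, exists v,
                          [&& u != v, r u v & ed == [set u; v]]]]).

Definition complete n : graph 'I_n := graph_of_rel (fun _ _ => true).

Definition complete_bipartite m n : graph ('I_m + 'I_n)%type :=
  graph_of_rel (fun u v =>
    match u, v with inl _, inr _ => true | _, _ => false end).

(* K_{n,n} with the edges of a perfect matching removed. *)
Definition complete_bipartite_minus_matching n : graph ('I_n + 'I_n)%type :=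
  graph_of_rel (fun u v =>
    match u, v with inl i, inr j => i != j | _, _ => false end).

(* The n-cycle; only meaningful for n >= 3. *)
Definition cycle_graph n : graph 'I_n := graph_of_rel (fun i j => j == ordS i).

(* The disjoint union of m copies of G. *)
Definition copies m (U : finType) (G : graph U) : graph ('I_m * U)%type :=
  (setX [set: 'I_m] (vset G),
   [set [set (i, u) | u in ed] | i : 'I_m in [set: 'I_m], ed : {set U} in eset G]).

Section Cycles.
Variable U : finType.
Implicit Types G C : graph U.

Definition ncycle_of n G C : bool :=
  [&& 3 <= n, subgraph C G & isomorphic (cycle_graph n) C].

(* The value #|U|.+1, larger than the length of any cycle, stands for the
   infinite girth of an acyclic graph. *)
Definition girth G : nat :=
  \big[minn/#|U|.+1]_(n < #|U|.+1 | [exists C, ncycle_of n G C]) n.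

Definition near_gonal n G (EE : {set graph U}) : Prop :=
  [/\ connected_graph G, 4 <= girth G,
      {in EE, forall C, ncycle_of n G C}
    & {in Arc 2 G, forall t, exists! C, C \in EE /\ t \in Arc 2 C}].

End Cycles.

Section Gimel.
Variable T : finType.
Implicit Types (S : graph T) (D : {set 4.-tuple T}) (a : T).

Definition gimel S D : graph {set 3.-tuple T} :=
  (Path 2 S,
   [set ed | [exists a0, exists a1, exists a2, exists a3,
      ([tuple a0; a1; a2; a3] \in D) &&
      (ed == [set path_of [tuple a0; a1; a2]; path_of [tuple a1; a2; a3]])]]).

Definition Pblock S a : {set {set 3.-tuple T}} :=
  [set p in Path 2 S | [exists b, exists c, p == path_of [tuple b; a; c]]].

(* The 3-arc graph; an arc (t, t1) is the 2-tuple [tuple t; t1]. *)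
Definition Xi S D : graph (2.-tuple T) :=
  (Arc 1 S,
   [set ed | [exists t, exists t1, exists s, exists s1,
      ([tuple t1; t; s; s1] \in D) &&
      (ed == [set [tuple t; t1]; [tuple s; s1]])]]).

Definition Ablock S a : {set 2.-tuple T} := [set [tuple a; b] | b in nbhd S a].

End Gimel.

Section InducedActions.
Variables (gT : finGroupType) (U : finType) (to : {action gT &-> U}).

Definition tuple_act n (t : n.-tuple U) (x : gT) : n.-tuple U :=
  map_tuple (fun u => to u x) t.

Lemma tuple_act1 n : (@tuple_act n)^~ 1 =1 id.
Proof. by move=> t; apply: eq_from_tnth => i; rewrite tnth_map act1. Qed.

Lemma tuple_actM n : forall t : n.-tuple U, act_morph (@tuple_act n) t.
Proof. by move=> t x y; apply: eq_from_tnth => i; rewrite !tnth_map actM. Qed.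

Definition tuple_action n := TotalAction (@tuple_act1 n) (@tuple_actM n).

Definition graph_act (G : graph U) (x : gT) : graph U :=
  ((to^*)%act (vset G) x, (to^*^*)%act (eset G) x).

Lemma graph_act1 : graph_act^~ 1 =1 id.
Proof. by case=> V E; rewrite /graph_act !act1. Qed.

Lemma graph_actM : forall G : graph U, act_morph graph_act G.
Proof. by move=> [V E] x y; rewrite /graph_act !actM. Qed.

Definition graph_action := TotalAction graph_act1 graph_actM.

End InducedActions.

Section Symmetry.
Variables (gT : finGroupType) (X : {group gT}) (U : finType).
Variables (to : {action gT &-> U}) (G : graph U).

Definition acts_on_graph : Prop :=
  [acts X, on vset G | to] /\
  {in X, forall x u v, adj G (to u x) (to v x) = adj G u v}.

Definition arc_transitive s : Prop :=
  [transitive X, on vset G | to] /\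
  [transitive X, on Arc s G | tuple_action to s.+1].

Definition arc_regular s : Prop :=
  arc_transitive s /\
  {in Arc s G, forall t, 'C_X[t | tuple_action to s.+1] = 1}.

(* "(X,1)-transitive": (X,1)- but not (X,2)-arc-transitive. *)
Definition one_transitive : Prop := arc_transitive 1 /\ ~ arc_transitive 2.

Definition self_paired_orbit s (D : {set s.+1.-tuple U}) : Prop :=
  D \in orbit (tuple_action to s.+1) X @: Arc s G /\ self_paired D.

Definition ncycle_orbit n (EE : {set graph U}) : Prop :=
  exists2 C, ncycle_of n G C & EE = orbit (graph_action to) X C.

(* X_[C]^[C], the group induced on the subgraph C by its stabiliser. *)
Definition induced_group (C : graph U) :=
  'C_X[C | graph_action to] / 'C_X(vset C | to).

End Symmetry.

(* Main.v *)
(** For a 2-arc (a, b, c) let k be the number of d with (a, b, c, d) in Delta; by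
    2-arc-transitivity k does not depend on the 2-arc, and k is 1, 2 or 3.

    A self-paired orbit exists because a 2-element of X that swaps the ends of an
    edge permutes the nine 3-paths with that middle edge, hence fixes one of them.

    If k = 1, Delta matches the outer ends of the 3-arcs through an arc, so an
    element fixing a vertex and all its neighbours fixes, by connectedness, every
    vertex; hence X_tau acts faithfully on 4 points and is A_4 or S_4, according
    to whether 2-arcs have a trivial stabiliser. If (a, b, c, d) is in Delta and g
    maps (a, b, c) to (b, c, d), then the successive Delta-extensions of (a, b, c)
    are the points a g^i: they run through the <g>-orbit of a, which is a cycle of
    Sigma with distinct vertices, and these cycles form one X-orbit. Every 2-arc
    lies in exactly one of them, so gimel is their disjoint union; counting
    2-paths gives mn = 6 mu, and m >= 6 because n <= mu.

    If k = 2 the complement of Delta is a self-paired orbit with k = 1, and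
    connectedness of gimel and Xi comes from two 2-subsets of a 3-set always
    meeting. If k = 3 then Delta consists of all 3-arcs. *)

Require Import Defs.
From mathcomp Require Import all_boot all_fingroup all_solvable.

Set Implicit Arguments.
Unset Strict Implicit.
Unset Printing Implicit Defensive.

Local Open Scope group_scope.

(** For k = 1 the element [g] attached to a 2-arc need not be unique: it may be multiplied on the
    left by any element of X fixing the three points. What is unique is the walk, because a sequence
    whose consecutive quadruples lie in Delta is determined by its first three points. Hence cycles,
    and their images under X, are compared on a single 2-arc. This yields the single orbit and the
    uniqueness of the cycle through a 2-arc. It also yields the dihedral groups: modulo the kernel,
    an element stabilising a cycle is known from its effect on one 2-arc of it; [g] is the rotation,
    and an element of X reversing that 2-arc is the reflection. The results for k = 1 are proved for
    an arbitrary self-paired orbit, so that for k = 2 they apply to the complement of Delta. *)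

Section GraphBasics.
Variable U : finType.
Implicit Types (G : graph U) (u v a b c d : U).

Lemma adj_sym G : symmetric (adj G).
Proof. by move=> u v; rewrite /adj eq_sym setUC. Qed.

Lemma adj_neq G u v : adj G u v -> u != v.
Proof. by case/andP. Qed.

Lemma adj_vset G u v : simple_graph G -> adj G u v -> u \in vset G.
Proof.
move/forall_inP=> sG /andP[_ /sG /andP[_ /subsetP]]; apply.
by rewrite !inE eqxx.
Qed.

Lemma tuple2_eta (t : 2.-tuple U) : exists a b, t = [tuple a; b].
Proof.
case/tupleP: t => a t; case/tupleP: t => b t; rewrite (tuple0 t).
by exists a, b; apply: val_inj.
Qed.

Lemma tuple3_eta (t : 3.-tuple U) : exists a b c, t = [tuple a; b; c].
Proof.
case/tupleP: t => a t; have [b [c ->]] := tuple2_eta t.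
by exists a, b, c; apply: val_inj.
Qed.

Lemma tuple4_eta (t : 4.-tuple U) : exists a b c d, t = [tuple a; b; c; d].
Proof.
case/tupleP: t => a t; have [b [c [d ->]]] := tuple3_eta t.
by exists a, b, c, d; apply: val_inj.
Qed.

Lemma tuple2_eq a b a' b' :
  [tuple a; b] = [tuple a'; b'] -> a = a' /\ b = b'.
Proof. by move/(congr1 val) => -[-> ->]. Qed.

Lemma tuple3_eq a b c a' b' c' :
  [tuple a; b; c] = [tuple a'; b'; c'] -> [/\ a = a', b = b' & c = c'].
Proof. by move/(congr1 val) => -[-> -> ->]. Qed.

Lemma tuple4_eq a b c d a' b' c' d' :
  [tuple a; b; c; d] = [tuple a'; b'; c'; d'] ->
  [/\ a = a', b = b', c = c' & d = d'].
Proof. by move/(congr1 val) => -[-> -> -> ->]. Qed.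

Lemma rev_tuple3 a b c : rev_tuple [tuple a; b; c] = [tuple c; b; a].
Proof. exact: val_inj. Qed.

Lemma rev_tuple4 a b c d : rev_tuple [tuple a; b; c; d] = [tuple d; c; b; a].
Proof. exact: val_inj. Qed.

(** Edges of a simple graph consist of vertices, so the membership clause of [Arc] follows from
    adjacency; likewise for the longer arcs below. *)
Lemma in_Arc1 G a b : simple_graph G -> ([tuple a; b] \in Arc 1 G) = adj G a b.
Proof.
move=> sG; rewrite inE; apply/and3P/idP => [[_ /forallP A _]|ab].
  exact: (forallP (A (@Ordinal 2 0 isT)) (@Ordinal 2 1 isT)).
have ba := ab; rewrite adj_sym in ba.
split.
- by apply/forallP => -[[|[|//]] i]; rewrite (tnth_nth a) /=; apply: adj_vset; eauto.
- apply/forallP => -[[|[|//]] i]; apply/forallP => -[[|[|//]] j];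
  by rewrite !(tnth_nth a).
- by apply/forallP => -[[|[|//]] i]; apply/forallP => -[[|[|//]] j].
Qed.

Lemma in_Arc2 G a b c : simple_graph G ->
  ([tuple a; b; c] \in Arc 2 G) = [&& adj G a b, adj G b c & a != c].
Proof.
move=> sG; rewrite inE; apply/and3P/and3P => [[_ /forallP A /forallP N]|].
  split; first exact: (forallP (A (@Ordinal 3 0 isT)) (@Ordinal 3 1 isT)).
    exact: (forallP (A (@Ordinal 3 1 isT)) (@Ordinal 3 2 isT)).
  exact: (forallP (N (@Ordinal 3 0 isT)) (@Ordinal 3 2 isT)).
move=> [ab bc ac]; have cb := bc; rewrite adj_sym in cb.
split.
- apply/forallP => -[[|[|[|//]]] i]; rewrite (tnth_nth a) /=;
  apply: adj_vset; eauto.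
- apply/forallP => -[[|[|[|//]]] i]; apply/forallP => -[[|[|[|//]]] j];
  by rewrite !(tnth_nth a).
- by apply/forallP => -[[|[|[|//]]] i]; apply/forallP => -[[|[|[|//]]] j];
  rewrite !(tnth_nth a).
Qed.

Lemma in_Arc3 G a b c d : simple_graph G ->
  ([tuple a; b; c; d] \in Arc 3 G)
    = [&& adj G a b, adj G b c, adj G c d, a != c & b != d].
Proof.
move=> sG; rewrite inE; apply/and3P/and5P => [[_ /forallP A /forallP N]|].
  split; first exact: (forallP (A (@Ordinal 4 0 isT)) (@Ordinal 4 1 isT)).
  - exact: (forallP (A (@Ordinal 4 1 isT)) (@Ordinal 4 2 isT)).
  - exact: (forallP (A (@Ordinal 4 2 isT)) (@Ordinal 4 3 isT)).
  - exact: (forallP (N (@Ordinal 4 0 isT)) (@Ordinal 4 2 isT)).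
  exact: (forallP (N (@Ordinal 4 1 isT)) (@Ordinal 4 3 isT)).
move=> [ab bc cd ac bd]; have dc := cd; rewrite adj_sym in dc.
split.
- apply/forallP => -[[|[|[|[|//]]]] i]; rewrite (tnth_nth a) /=;
  apply: adj_vset; eauto.
- apply/forallP => -[[|[|[|[|//]]]] i];
  apply/forallP => -[[|[|[|[|//]]]] j];
  by rewrite !(tnth_nth a).
- by apply/forallP => -[[|[|[|[|//]]]] i];
  apply/forallP => -[[|[|[|[|//]]]] j];
  rewrite !(tnth_nth a).
Qed.

Lemma path_of3_eq a b c a' b' c' :
  path_of [tuple a; b; c] = path_of [tuple a'; b'; c'] ->
  b = b' /\ ((a = a' /\ c = c') \/ (a = c' /\ c = a')).
Proof.
rewrite /path_of !rev_tuple3 => E.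
have: [tuple a; b; c] \in [set [tuple a'; b'; c']; [tuple c'; b'; a']].
  by rewrite -E !inE eqxx.
by rewrite !inE => /orP[] /eqP/tuple3_eq[-> -> ->]; split; auto.
Qed.

Lemma path_of3_rev a b c :
  path_of [tuple c; b; a] = path_of [tuple a; b; c].
Proof. by rewrite /path_of !rev_tuple3 setUC. Qed.

Lemma in_Path2 G a b c : simple_graph G ->
  (path_of [tuple a; b; c] \in Path 2 G) = [&& adj G a b, adj G b c & a != c].
Proof.
move=> sG; apply/imsetP/idP => [[t]|arc].
  rewrite inE => /andP[tA _]; have [x [y [z tE]]] := tuple3_eta t.
  rewrite {}tE in tA *; rewrite in_Arc2 // in tA.
  case/path_of3_eq=> -> [[-> ->]|[-> ->]] //.
  by rewrite adj_sym [adj _ _ x]adj_sym eq_sym andbCA.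
exists [tuple a; b; c] => //; rewrite inE in_Arc2 // arc /=.
case/and3P: arc => /adj_neq ab /adj_neq bc ac.
by rewrite !inE negb_or ab ac bc.
Qed.

Lemma Path2P G p : simple_graph G ->
  reflect (exists a b c, [&& adj G a b, adj G b c & a != c] /\
             p = path_of [tuple a; b; c]) (p \in Path 2 G).
Proof.
move=> sG; apply: (iffP idP) => [pG|[a [b [c [? ->]]]]]; last by rewrite in_Path2.
case/imsetP: (pG) => t _ E; have [a [b [c tE]]] := tuple3_eta t.
by exists a, b, c; rewrite E tE -in_Path2 // -tE -E.
Qed.

Lemma in_nbhd G u v : (v \in nbhd G u) = adj G u v.
Proof. by rewrite inE. Qed.

Lemma set2_eq (a b c d : U) :
  [set a; b] = [set c; d] -> (a = c /\ b = d) \/ (a = d /\ b = c).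
Proof.
move=> E; have: a \in [set c; d] by rewrite -E !inE eqxx.
have: b \in [set c; d] by rewrite -E !inE eqxx orbT.
have: c \in [set a; b] by rewrite E !inE eqxx.
have: d \in [set a; b] by rewrite E !inE eqxx orbT.
rewrite !inE => /orP[]/eqP-> /orP[]/eqP-> /orP[]/eqP E1 /orP[]/eqP E2; subst; auto.
Qed.

End GraphBasics.

(** * Isomorphisms of graphs and bipartite subgraphs *)

Section Isomorphisms.

Lemma isomorphicI (U W : finType) (G : graph U) (H : graph W) (f : U -> W) :
  {in vset G &, injective f} -> f @: vset G = vset H ->
  {in vset G &, forall u v, adj H (f u) (f v) = adj G u v} ->
  isomorphic G H.
Proof.
move=> f_inj f_im f_adj; apply/existsP; exists (finfun f); apply/and3P; split.
- by apply/dinjectiveP => u v uG vG; rewrite !ffunE; apply: f_inj.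
- by apply/eqP; rewrite -f_im; apply: eq_imset => u; rewrite ffunE.
- apply/forall_inP=> u uG; apply/forall_inP=> v vG.
  by rewrite !ffunE f_adj.
Qed.

Lemma isomorphicP (U W : finType) (G : graph U) (H : graph W) :
  isomorphic G H -> exists f : U -> W,
  [/\ {in vset G &, injective f}, f @: vset G = vset H &
  {in vset G &, forall u v, adj H (f u) (f v) = adj G u v}].
Proof.
case/existsP=> f /and3P[/dinjectiveP f_inj /eqP f_im /forall_inP f_adj].
exists f; split=> // u v uG vG.
by move/forall_inP: (f_adj u uG) => /(_ v vG)/eqP.
Qed.

(** Parametrising [G] by [H] is the convenient direction when [H] is a standard graph; [w0] is only
    the value of the inverse map outside [G]. *)
Lemma isomorphic_inv (U W : finType) (G : graph U) (H : graph W)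
    (w0 : W) (h : W -> U) :
  {in vset H &, injective h} -> h @: vset H = vset G ->
  {in vset H &, forall u v, adj G (h u) (h v) = adj H u v} ->
  isomorphic G H.
Proof.
move=> h_inj h_im h_adj.
pose f u := odflt w0 [pick w in vset H | h w == u].
have fK: {in vset H, cancel h f}.
  move=> w wH; rewrite /f; case: pickP => [w' /andP[w'H /eqP]|/(_ w)/=].
    exact: h_inj.
  by rewrite wH eqxx.
have G_im u : u \in vset G -> exists2 w, w \in vset H & u = h w.
  by rewrite -h_im => /imsetP.
apply: (@isomorphicI _ _ _ _ f).
- move=> u v /G_im[w wH ->] /G_im[w' w'H ->]; rewrite !fK //; exact: congr1.
- rewrite -h_im -imset_comp; apply/setP=> w; apply/imsetP/idP => [[w' w'H ->]|wH].
    by rewrite /= fK.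
  by exists w => //=; rewrite fK.
- by move=> u v /G_im[w wH ->] /G_im[w' w'H ->]; rewrite !fK // h_adj.
Qed.

Lemma isomorphic_trans (U W Z : finType) (G : graph U) (H : graph W) (K : graph Z) :
  isomorphic G H -> isomorphic H K -> isomorphic G K.
Proof.
move=> /isomorphicP[f [fi fim fa]] /isomorphicP[h [hi him ha]].
have fH u : u \in vset G -> f u \in vset H by move=> uG; rewrite -fim imset_f.
apply: (@isomorphicI _ _ _ _ (h \o f)).
- by move=> u v uG vG /= /hi E; apply: fi => //; apply: E; apply: fH.
- by rewrite imset_comp fim.
- by move=> u v uG vG /=; rewrite ha ?fa ?fH.
Qed.

Lemma isomorphic_card (U W : finType) (G : graph U) (H : graph W) :
  isomorphic G H -> #|vset G| = #|vset H|.
Proof. by case/isomorphicP=> f [fi <- _]; rewrite card_in_imset. Qed.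

Lemma adj_graph_of_rel (U : finType) (r : rel U) u v :
  adj (graph_of_rel r) u v = (u != v) && (r u v || r v u).
Proof.
rewrite /adj inE; case: (boolP (u == v)) => //= uv.
apply/existsP/orP => [[a /existsP[b /and3P[_ ab /eqP/set2_eq]]]|].
  by case=> -[-> ->]; auto.
case=> uv'; first by exists u; apply/existsP; exists v; rewrite uv uv' eqxx.
by exists v; apply/existsP; exists u; rewrite eq_sym uv uv' setUC eqxx.
Qed.

Lemma adj_copies m (U : finType) (G : graph U) (i j : 'I_m) u v :
  adj (copies m G) (i, u) (j, v) = (i == j) && adj G u v.
Proof.
rewrite /adj /=; apply/andP/and3P => [[ne]|[/eqP <- ne uv]].
  case/imset2P=> k ed _ edG E.
  have: (i, u) \in [set (k, w) | w in ed] by rewrite -E !inE eqxx.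
  case/imsetP=> u' u'e [ik uu']; subst u' k.
  have: (j, v) \in [set (i, w) | w in ed] by rewrite -E !inE eqxx orbT.
  case/imsetP=> v' v'e [ij vv']; subst v' j.
  split=> //; first by apply: contraNneq ne => ->.
  suff -> : [set u; v] = ed by [].
  apply/setP=> w; rewrite !inE; apply/idP/idP => [/orP[]/eqP->//|wE].
  have: (i, w) \in [set (i, u); (i, v)] by rewrite E imset_f.
  by rewrite !inE !xpair_eqE eqxx.
split; first by rewrite xpair_eqE eqxx.
apply/imset2P; exists i [set u; v]; rewrite ?inE //.
by rewrite imsetU1 imset_set1.
Qed.

(** The common shape of the three bipartite graphs of the theorem: with [R] the inequality or the
    full relation on ['I_3] it unfolds to K_{3,3}-3K_2 or K_{3,3}, and with equality it is
    isomorphic to 3K_2. *)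
Definition bipartite_of n (R : rel 'I_n) : graph ('I_n + 'I_n)%type :=
  graph_of_rel (fun u v => match u, v with inl i, inr j => R i j | _, _ => false end).

Lemma adj_between (U : finType) (G : graph U) (P Q : {set U}) u v :
  adj (between G P Q) u v
    = adj G u v && ((u \in P) && (v \in Q) || (u \in Q) && (v \in P)).
Proof.
rewrite /adj inE; case: (boolP (u == v)) => //= uv.
case: (boolP ([set u; v] \in _)) => //= uvG; apply/exists_inP/idP.
  case=> x; rewrite inE => /andP[xP _] /exists_inP[y].
  rewrite inE => /andP[yQ _] /eqP/set2_eq[] [-> ->]; rewrite xP yQ ?orbT //.
case/orP=> /andP[uP vQ].
  exists u; first by rewrite inE uP; apply/exists_inP; exists v; rewrite // /adj uv.
  apply/exists_inP; exists v => //; rewrite inE vQ; apply/exists_inP.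
  by exists u; rewrite // adj_sym /adj uv.
exists v.
  by rewrite inE vQ; apply/exists_inP; exists u; rewrite // adj_sym /adj uv.
apply/exists_inP; exists u; last by rewrite setUC.
by rewrite inE uP; apply/exists_inP; exists v; rewrite // /adj uv.
Qed.

(** [P] and [Q] may contain further vertices, which [between] drops for lack of neighbours on the
    other side. So [p] and [q] need only reach the ends of edges, while [R] must have no empty row
    or column. *)
Lemma between_isomorphic (U : finType) (G : graph U) (P Q : {set U}) n
    (p q : 'I_n.+1 -> U) (R : rel 'I_n.+1) :
    [disjoint P & Q] -> injective p -> injective q ->
    (forall i, p i \in P) -> (forall j, q j \in Q) ->
    (forall i j, adj G (p i) (q j) = R i j) ->
    (forall u v, u \in P -> v \in Q -> adj G u v ->
       exists i j, u = p i /\ v = q j) ->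
    (forall i, exists j, R i j) -> (forall j, exists i, R i j) ->
  isomorphic (between G P Q) (bipartite_of R).
Proof.
move=> dPQ p_inj q_inj pP qQ pq_adj pq_all Rl Rr.
have disj u : u \in P -> u \in Q -> False.
  by move=> uP uQ; rewrite (disjointFr dPQ uP) in uQ.
pose h (w : 'I_n.+1 + 'I_n.+1) := match w with inl i => p i | inr j => q j end.
apply: (@isomorphic_inv _ _ _ _ (inl ord0) h).
- move=> [i|i] [j|j] _ _ /= E; rewrite ?(p_inj _ _ E) ?(q_inj _ _ E) //.
    by case: (disj (p i)); rewrite ?pP // E qQ.
  by case: (disj (p j)); rewrite ?pP // -E qQ.
- apply/setP=> u; apply/imsetP/idP => [[[i|j] _ ->] /=|].
  + have [j Rij] := Rl i; apply/setUP; left; rewrite inE pP; apply/exists_inP.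
    by exists (q j); rewrite ?qQ ?pq_adj.
  + have [i Rij] := Rr j; apply/setUP; right; rewrite inE qQ; apply/exists_inP.
    by exists (p i); rewrite ?pP // adj_sym ?pq_adj.
  case/setUP; rewrite inE => /andP[uP /exists_inP[v vQ uv]].
    by have [i [j [-> _]]] := pq_all _ _ uP vQ uv; exists (inl i).
  rewrite adj_sym in uv.
  by have [i [j [_ ->]]] := pq_all _ _ vQ uP uv; exists (inr j).
have NP j : q j \in P = false by apply/negP => /disj; apply.
have NQ i : p i \in Q = false by apply/negP => H; apply: (disj (p i)).
move=> [i|i] [j|j] _ _; rewrite adj_between adj_graph_of_rel /=.
- by rewrite !NQ /= !andbF.
- by rewrite pP qQ pq_adj /= ?andbT ?orbF.
- by rewrite pP qQ NP NQ adj_sym pq_adj /= ?andbT.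
- by rewrite !NP /= !andbF.
Qed.

Lemma bipartite_matching_copies n :
  isomorphic (bipartite_of (fun i j : 'I_n => i == j)) (copies n (complete 2)).
Proof.
pose f (w : 'I_n + 'I_n) : 'I_n * 'I_2 :=
  match w with inl i => (i, ord0) | inr j => (j, ord_max) end.
apply: (@isomorphicI _ _ _ _ f).
- by move=> [i|i] [j|j] _ _ // [->].
- apply/setP=> -[i k]; rewrite !inE; apply/imsetP.
  have [->|k1] := eqVneq k ord0; first by exists (inl i).
  exists (inr i) => //; congr pair; apply: val_inj.
  by case: k k1 => -[|[|//]].
- move=> [i|i] [j|j] _ _; rewrite adj_copies !adj_graph_of_rel /= ?andbF //= andbT //.
Qed.

End Isomorphisms.

(** * Tools for connectivity, counting and transitivity *)

Lemma connect_ind (U : finType) (e : rel U) (Q : U -> Prop) x y :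
  Q x -> (forall u v, Q u -> e u v -> Q v) -> connect e x y -> Q y.
Proof.
move=> Qx Qstep /connectP[p]; elim: p x Qx => [|z p IH] x Qx /=.
  by move=> _ ->.
by case/andP=> xz zp; apply: IH => //; apply: Qstep xz.
Qed.

Lemma card_fibers (U W : finType) (A : {set U}) (B : {set W}) (f : U -> W) k :
  {in A, forall u, f u \in B} ->
  {in B, forall w, #|[set u in A | f u == w]| = k} -> #|A| = (k * #|B|)%N.
Proof.
move=> fB fk; rewrite -sum1_card (partition_big f (mem B)) //= mulnC.
rewrite -sum_nat_const; apply: eq_bigr => w wB; rewrite -(fk w wB) -sum1_card.
by apply: eq_bigl => u; rewrite inE.
Qed.

Lemma enum_set (U : finType) (A : {set U}) n : #|A| = n ->
  exists2 l : 'I_n -> U, injective l & forall u, u \in A <-> exists i, u = l i.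
Proof.
move=> cA; exists (fun i => enum_val (cast_ord (esym cA) i)).
  by move=> i j /enum_val_inj/cast_ord_inj.
move=> u; split=> [uA|[i ->]]; last exact: enum_valP.
by exists (cast_ord cA (enum_rank_in uA u)); rewrite cast_ordK enum_rankK_in.
Qed.

Lemma atransI (gT : finGroupType) (U : finType) (to : {action gT &-> U})
    (X : {group gT}) (S : {set U}) u :
  u \in S -> (forall v, v \in S -> exists2 x, x \in X & to u x = v) ->
  (forall x v, x \in X -> v \in S -> to v x \in S) ->
  [transitive X, on S | to].
Proof.
move=> uS tr clS; apply/imsetP; exists u => //; apply/setP=> v.
apply/idP/orbitP => [/tr[x xX <-]|[x xX <-]]; first by exists x.
exact: clS.
Qed.

(** * Bounds on the girth *)

Section Girth.
Variable U : finType.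
Implicit Types G C : graph U.

Lemma card_ncycle n G C : ncycle_of n G C -> #|vset C| = n.
Proof. by case/and3P=> _ _ /isomorphic_card <-; rewrite cardsT card_ord. Qed.

Lemma girth_le n G C : ncycle_of n G C -> girth G <= n.
Proof.
move=> nC; have nU : n < #|U|.+1 by rewrite ltnS -(card_ncycle nC) max_card.
rewrite /girth -[n]/(nat_of_ord (Ordinal nU)).
have: [exists C, ncycle_of (Ordinal nU) G C] by apply/existsP; exists C.
elim: (index_enum _) (mem_index_enum (Ordinal nU)) => // i r IH.
rewrite inE big_cons => /predU1P[<- ->|ir P]; first exact: geq_minl.
by case: ifP => _; [apply: leq_trans (geq_minr _ _) _ |]; apply: IH.
Qed.

Lemma leq_girth k G : k <= #|U|.+1 ->
  (forall n C, ncycle_of n G C -> k <= n) -> k <= girth G.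
Proof.
move=> kU kC; rewrite /girth; apply: (big_ind (leq k)) => //.
  by move=> x y kx ky; rewrite leq_min kx.
by move=> i /existsP[C /kC].
Qed.

End Girth.

(** * Action on short tuples and paths *)

Section Actions.
Variables (gT : finGroupType) (T : finType) (to : {action gT &-> T}).
Implicit Types (a b c d : T) (x : gT).

Lemma tuple_act2E a b x :
  tuple_act to [tuple a; b] x = [tuple to a x; to b x].
Proof. exact: val_inj. Qed.

Lemma tuple_act3E a b c x :
  tuple_act to [tuple a; b; c] x = [tuple to a x; to b x; to c x].
Proof. exact: val_inj. Qed.

Lemma tuple_act4E a b c d x :
  tuple_act to [tuple a; b; c; d] x = [tuple to a x; to b x; to c x; to d x].
Proof. exact: val_inj. Qed.

Lemma path_of_act n (t : n.-tuple T) x :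
  ((tuple_action to n)^*)%act (path_of t) x = path_of (tuple_act to t x).
Proof.
rewrite /= setactE /path_of imsetU1 imset_set1 /=; congr [set _; _].
by apply: val_inj; rewrite /= map_rev.
Qed.

End Actions.

Lemma mem_stab1 (gT : finGroupType) (T : finType) (to : {action gT &-> T})
    (A : {set gT}) u x : x \in A -> to u x = u -> x \in 'C_A[u | to].
Proof. by move=> xA /astab1P xu; apply/setIP. Qed.

(** * The closed walk traced by the powers of one element *)

Section OrbitCycle.
Variables (gT : finGroupType) (T : finType) (to : {action gT &-> T}).
Implicit Types (a b u v : T) (g x : gT).

(** The length is the size of the orbit of [a], possibly a proper divisor of the order of [g]. For
    orbits of size at most 2 this is not a cycle; such orbits are excluded later by [rotary]. *)
Definition orbit_cycle a g : graph T :=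
  (orbit to <[g]> a, [set [set u; to u g] | u in orbit to <[g]> a]).

Lemma orbit_cycleP a g u :
  reflect (exists i, u = to a (g ^+ i)) (u \in orbit to <[g]> a).
Proof.
apply: (iffP orbitP) => [[_ /cycleP[i ->] <-]|[i ->]]; first by exists i.
by exists (g ^+ i); rewrite ?mem_cycle.
Qed.

Lemma orbit_cycle_actr a g u :
  (to u g \in orbit to <[g]> a) = (u \in orbit to <[g]> a).
Proof. exact/orbit_actr/cycle_id. Qed.

Lemma adj_orbit_cycle a g u v : adj (orbit_cycle a g) u v =
  [&& u != v, u \in orbit to <[g]> a & (v == to u g) || (u == to v g)].
Proof.
rewrite /adj; apply: andb_id2l => uv; apply/imsetP/andP => [[w wO]|].
  case/set2_eq=> -[-> ->]; rewrite ?eqxx ?orbT //.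
  by rewrite orbit_cycle_actr.
case=> uO /orP[/eqP->|/eqP E]; first by exists u.
by exists v; rewrite -?E 1?setUC // -(orbit_cycle_actr a) -E.
Qed.

(** Only the sequence of points matters, so different elements may trace the same cycle. *)
Lemma orbit_cycle_ext a g b g' :
  (forall i, to a (g ^+ i) = to b (g' ^+ i)) -> orbit_cycle a g = orbit_cycle b g'.
Proof.
move=> E; have O : orbit to <[g]> a = orbit to <[g']> b.
  by apply/setP=> u; apply/orbit_cycleP/orbit_cycleP => -[i ->]; exists i.
rewrite /orbit_cycle -O; congr pair; apply: eq_in_imset => _ /orbit_cycleP[i ->].
by congr [set _; _]; rewrite -actM -expgSr !E expgSr actM.
Qed.

Lemma orbit_cycle_act a g x :
  graph_act to (orbit_cycle a g) x = orbit_cycle (to a x) (g ^ x).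
Proof.
have O : (to^*)%act (orbit to <[g]> a) x = orbit to <[g ^ x]> (to a x).
  by rewrite /= setact_orbit cycleJ.
rewrite /graph_act O; congr pair; rewrite -O /= !setactE -!imset_comp.
apply: eq_imset => u /=; rewrite setactE imsetU1 imset_set1.
by rewrite -actCJ.
Qed.

Lemma orbit_cycle_shift a g u :
  u \in orbit to <[g]> a -> orbit_cycle u g = orbit_cycle a g.
Proof. by rewrite /orbit_cycle => /orbit_eqP->. Qed.

Lemma orbit_cycle_inv a g : orbit_cycle a g^-1 = orbit_cycle a g.
Proof.
rewrite /orbit_cycle cycleV; congr pair; apply/setP=> e.
apply/imsetP/imsetP => -[u uO ->].
  exists (to u g^-1); first by rewrite -(orbit_cycle_actr a) actKV.
  by rewrite actKV setUC.
exists (to u g); first by rewrite orbit_cycle_actr.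
by rewrite actK setUC.
Qed.

(** Identifies the orbit with the iterates of one injective function, whose theory supplies both
    periodicity and distinctness of the points within a period. *)
Lemma order_orbit_cycle a g : fingraph.order (to^~ g) a = #|orbit to <[g]> a|.
Proof.
rewrite /fingraph.order -cardsE; apply: eq_card => u; rewrite !inE.
apply/idP/orbit_cycleP => [au|[i ->]].
  by exists (findex (to^~ g) a u); rewrite actX iter_findex.
by rewrite actX fconnect_iter.
Qed.

Lemma orbit_cycle_period a g : to a (g ^+ #|orbit to <[g]> a|) = a.
Proof. by rewrite -order_orbit_cycle actX iter_order //; apply: act_inj. Qed.

Lemma orbit_cycle_modn a g i :
  to a (g ^+ (i %% #|orbit to <[g]> a|)) = to a (g ^+ i).
Proof.
rewrite {2}(divn_eq i #|orbit to <[g]> a|).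
elim: (i %/ _)%N => [//|q ->].
by rewrite mulSn -addnA (expgD _ #|_|) actM orbit_cycle_period.
Qed.

Lemma orbit_cycle_injn a g i j : i < #|orbit to <[g]> a| -> j < #|orbit to <[g]> a| ->
  to a (g ^+ i) = to a (g ^+ j) -> i = j.
Proof.
rewrite -order_orbit_cycle !actX => li lj E.
by rewrite -(findex_iter li) E findex_iter.
Qed.

End OrbitCycle.

(** * Connected 2-arc-transitive graphs of valency 4 *)

Section TwoArcTransitive.
Variables (T : finType) (Sigma : graph T).
Variables (gT : finGroupType) (X : {group gT}) (to : {action gT &-> T}).
Hypothesis Sigma_simple : simple_graph Sigma.
Hypothesis Sigma_connected : connected_graph Sigma.
Hypothesis Sigma_val4 : has_valency Sigma 4.
Hypothesis X_acts : acts_on_graph X to Sigma.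
Hypothesis X_faithful : [faithful X, on vset Sigma | to].
Hypothesis X_2arc : arc_transitive X to Sigma 2.

Implicit Types (a b c d u v : T) (x y : gT).
Local Notation V := (vset Sigma).
Local Notation "u ~ v" := (adj Sigma u v) (at level 70).
Local Notation arc2 a b c := [&& a ~ b, b ~ c & a != c].
Local Notation pth a b c := (path_of [tuple a; b; c]).

Lemma adj_act x u v : x \in X -> (to u x ~ to v x) = (u ~ v).
Proof. by move=> xX; case: X_acts => _ ->. Qed.

Lemma act_eq x u v : (to u x == to v x) = (u == v).
Proof. exact: (inj_eq (act_inj to x)). Qed.

Lemma arc2_act x a b c : x \in X ->
  arc2 (to a x) (to b x) (to c x) = arc2 a b c.
Proof. by move=> xX; rewrite !adj_act // act_eq. Qed.

Lemma arc2_rev a b c : arc2 c b a = arc2 a b c.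
Proof. by rewrite adj_sym [b ~ a]adj_sym eq_sym andbCA. Qed.

Lemma arc2_trans a b c a' b' c' : arc2 a b c -> arc2 a' b' c' ->
  exists x, [/\ x \in X, to a x = a', to b x = b' & to c x = c'].
Proof.
move=> abc abc'; case: X_2arc => _ tr.
rewrite -in_Arc2 // in abc; rewrite -in_Arc2 // in abc'.
have [x xX] := atransP2 tr abc abc'.
by rewrite /= tuple_act3E => /tuple3_eq[-> -> ->]; exists x.
Qed.

Lemma exists_nbr u (s : seq T) : u \in V -> size s < 4 ->
  exists2 v, u ~ v & v \notin s.
Proof.
move=> uV s4; have: ~~ (nbhd Sigma u \subset [set v in s]).
  apply/negP=> /subset_leq_card; rewrite Sigma_val4 //.
  by apply/negP; rewrite -ltnNge (leq_ltn_trans _ s4) // cardsE card_size.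
by case/subsetPn=> v; rewrite !inE => uv vs; exists v.
Qed.

Lemma adj_vsetl u v : u ~ v -> u \in V.
Proof. exact: adj_vset. Qed.

Lemma adj_vsetr u v : u ~ v -> v \in V.
Proof. by rewrite adj_sym; apply: adj_vset. Qed.

Lemma arc_extend u v : u ~ v -> exists w, arc2 u v w.
Proof.
move=> uv; have [w vw] := @exists_nbr v [:: u] (adj_vsetr uv) isT.
by rewrite inE => wu; exists w; rewrite uv vw eq_sym.
Qed.

Lemma arc_trans a b a' b' : a ~ b -> a' ~ b' ->
  exists x, [/\ x \in X, to a x = a' & to b x = b'].
Proof.
move=> /arc_extend[c abc] /arc_extend[c' abc'].
by have [x [xX <- <- _]] := arc2_trans abc abc'; exists x.
Qed.

Lemma vset_neq0 : exists u, u \in V.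
Proof.
by case: X_2arc => [/imsetP[u uV _] _]; exists u.
Qed.

Lemma card_nbhdD1 u v : u ~ v -> #|nbhd Sigma u :\ v| = 3.
Proof.
move=> uv; apply/eqP; rewrite -(eqn_add2l 1).
have := cardsD1 v (nbhd Sigma u).
by rewrite (Sigma_val4 (adj_vsetl uv)) in_nbhd uv => <-.
Qed.

Lemma exists_self_paired_orbit :
  exists Delta : {set 4.-tuple T}, self_paired_orbit X to Sigma Delta.
Proof.
have [tau tauV] := vset_neq0.
have [sg ts _] := @exists_nbr tau [::] tauV isT.
have st := ts; rewrite adj_sym in st.
have nts := adj_neq ts.
have [x [xX xt xs]] := arc_trans ts st.
(* [k] is the part of the order of [x] prime to 2. So [g] has 2-power order, and since [k] is odd it
   still exchanges [tau] and [sg]. *)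
pose k := (#[x]`_2^')%N; pose g := x ^+ k.
have gX : g \in X by rewrite groupX.
have iter_swap i u v : to u x = v -> to v x = u ->
    iter i (to^~ x) u = if odd i then v else u.
  by move=> uv vu; elim: i => //= i ->; case: (odd i).
have odd_k : odd k by rewrite odd_2'nat part_pnat.
have gt : to tau g = sg by rewrite /g actX (iter_swap _ tau sg) ?odd_k.
have gs : to sg g = tau by rewrite /g actX (iter_swap _ sg tau) ?odd_k.
have pg : 2.-group <[g]>.
  apply: (@pnat_dvd _ (#[x]`_2)); last exact: part_pnat.
  by rewrite order_dvdn -expgM mulnC partnC ?expg_order.
pose L := nbhd Sigma tau :\ sg; pose R := nbhd Sigma sg :\ tau.
have cL : #|L| = 3 by apply: card_nbhdD1.
have cR : #|R| = 3 by apply: card_nbhdD1.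
(* [g] reverses the middle arc, so 3-arcs are identified with their reverses to obtain a set that
   [g] preserves. *)
pose F (w : T * T) := path_of [tuple w.1; tau; sg; w.2].
have F_eq a b a' b' :
    path_of [tuple a; tau; sg; b] = path_of [tuple a'; tau; sg; b'] ->
    a = a' /\ b = b'.
  rewrite /path_of !rev_tuple4 => E.
  have: [tuple a; tau; sg; b]
      \in [set [tuple a'; tau; sg; b']; [tuple b'; sg; tau; a']].
    by rewrite -E !inE eqxx.
  rewrite !inE => /orP[] /eqP/tuple4_eq[] // _ E1.
  by rewrite E1 eqxx in nts.
have rev_eq a b : path_of [tuple a; sg; tau; b] = path_of [tuple b; tau; sg; a].
  by rewrite /path_of !rev_tuple4 setUC.
pose S := F @: setX L R.
have cS : #|S| = 9.
  rewrite card_in_imset ?cardsX ?cL ?cR //.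
  by move=> [a b] [a' b'] _ _ /F_eq /= [-> ->].
have FE a b : ((tuple_action to 4)^*)%act (F (a, b)) g = F (to b g, to a g).
  by rewrite path_of_act tuple_act4E gt gs rev_eq.
have actS : [acts <[g]>, on S | (tuple_action to 4)^*].
  rewrite cycle_subG !inE; apply/subsetP=> _ /imsetP[[a b] abS ->].
  rewrite inE FE; apply: imset_f; move: abS; rewrite !inE /=.
  case/andP=> /andP[nas ta] /andP[nbt sb].
  have -> : (to b g == sg) = (b == tau) by rewrite -gt act_eq.
  have -> : (to a g == tau) = (a == sg) by rewrite -gs act_eq.
  have -> : (tau ~ to b g) = (sg ~ b) by rewrite -{1}gs adj_act.
  have -> : (sg ~ to a g) = (tau ~ a) by rewrite -{1}gt adj_act.
  by rewrite nas nbt sb ta.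
have := pgroup_fix_mod pg actS; rewrite cS.
set Fx := (X in #|X|) => mod2.
have /card_gt0P[p] : 0 < #|Fx|.
  by rewrite lt0n; apply/eqP=> E; rewrite E in mod2.
rewrite inE => /andP[/imsetP[[a b] abS ->] /afixP/(_ g (cycle_id g))].
rewrite FE => /F_eq[/= gb ga].
move: abS; rewrite !inE /= => /andP[/andP[nas ta] /andP[nbt sb]].
pose t := [tuple a; tau; sg; b].
exists (orbit (tuple_action to 4) X t); split.
  apply: imset_f; rewrite in_Arc3 //.
  by rewrite adj_sym ta ts sb nas eq_sym nbt.
move=> _ /orbitP[y yX <-].
(* The fixed 3-path has its ends exchanged by [g]. So [g] reverses the 3-arc [t], and the reverse of
   any image of [t] is again an image of [t]. *)
have -> : rev_tuple (tuple_action to 4 t y) = tuple_action to 4 t (g * y).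
  by apply: val_inj; rewrite /= !actM gt gs gb ga.
by apply: mem_orbit; rewrite groupM.
Qed.

(** Arcs are counted once by their edge, with two arcs each, and once by their initial vertex, with
    four each. *)
Lemma card_eset : (2 * #|eset Sigma| = 4 * #|V|)%N.
Proof.
rewrite -(@card_fibers _ _ (Arc 1 Sigma) (eset Sigma)
           (fun t => [set thead t; tnth t ord_max])).
- apply: (card_fibers (f := fun t => thead t)) => [t|u uV].
    have [a [b ->]] := tuple2_eta t; rewrite in_Arc1 // theadE.
    exact: adj_vsetl.
  rewrite -(Sigma_val4 uV).
  have -> : [set t in Arc 1 Sigma | thead t == u]
      = (fun v => [tuple u; v]) @: nbhd Sigma u.
    apply/setP=> t; have [a [b ->]] := tuple2_eta t.
    rewrite inE in_Arc1 // theadE; apply/andP/imsetP => [[ab /eqP<-]|[c]].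
      by exists b; rewrite ?in_nbhd.
    by rewrite in_nbhd => uc /tuple2_eq[-> ->].
  by rewrite card_imset // => v w /tuple2_eq[].
- move=> t; have [a [b ->]] := tuple2_eta t; rewrite in_Arc1 //.
  by case/andP.
move=> ed edS; have /andP[/cards2P[a [b [ab edE]]] _] := forall_inP Sigma_simple ed edS.
have ab_adj : a ~ b by rewrite /adj ab -edE.
have -> : [set t in Arc 1 Sigma | [set thead t; tnth t ord_max] == ed]
    = [set [tuple a; b]; [tuple b; a]].
  apply/setP=> t; have [c [d ->]] := tuple2_eta t.
  rewrite inE in_Arc1 // edE !inE.
  have -> : [set thead [tuple c; d]; tnth [tuple c; d] ord_max] = [set c; d] by [].
  apply/andP/orP => [[_ /eqP/set2_eq[] [-> ->]]|]; auto.
  case=> /eqP/tuple2_eq[-> ->]; first by rewrite ab_adj.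
  by rewrite adj_sym ab_adj setUC.
rewrite cards2; case: eqP => // /tuple2_eq[E _].
by rewrite E eqxx in ab.
Qed.

(** Each 2-path comes from two 2-arcs, and each middle vertex carries 4 * 3 = 12 of these. *)
Lemma card_Path2 : #|Path 2 Sigma| = (6 * #|V|)%N.
Proof.
apply/eqP; rewrite -(eqn_pmul2l (isT : 0 < 2)) mulnA.
rewrite -(@card_fibers _ _ (Arc 2 Sigma) _ (@path_of T 3)).
- rewrite (@card_fibers _ _ (Arc 2 Sigma) V (fun t => tnth t (inord 1)) 12) //.
    move=> t; have [a [b [c ->]]] := tuple3_eta t; rewrite in_Arc2 //.
    rewrite (tnth_nth a) inordK //=.
    by case/and3P=> _ /adj_vsetl.
  move=> u uV; rewrite (@card_fibers _ _ _ (nbhd Sigma u) (fun t => thead t) 3).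
  + by rewrite Sigma_val4.
  + move=> t; have [a [b [c ->]]] := tuple3_eta t.
    rewrite inE in_Arc2 // theadE (tnth_nth a) inordK //= in_nbhd.
    by case/andP=> /and3P[ab _ _] /eqP<-; rewrite adj_sym.
  move=> a; rewrite in_nbhd => ua.
  transitivity #|nbhd Sigma u :\ a|; last exact: card_nbhdD1.
  have -> : [set t in [set t in Arc 2 Sigma | tnth t (inord 1) == u] | thead t == a]
      = (fun c => [tuple a; u; c]) @: (nbhd Sigma u :\ a).
    apply/setP=> t; have [a' [u' [c ->]]] := tuple3_eta t.
    rewrite inE inE in_Arc2 // theadE (tnth_nth a) inordK //=.
    apply/andP/imsetP => [[/andP[/and3P[_ uc ac] /eqP<-] /eqP<-]|[c']].
      by exists c; rewrite // !inE eq_sym ac.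
    rewrite !inE => /andP[ca uc] /tuple3_eq[-> -> ->].
    by rewrite adj_sym ua uc eq_sym ca !eqxx.
  by rewrite card_imset // => v w /tuple3_eq[].
- move=> t; have [a [b [c ->]]] := tuple3_eta t; rewrite in_Arc2 // => abc.
  by rewrite in_Path2.
move=> _ /(Path2P _ Sigma_simple)[a [b [c [abc ->]]]].
have -> : [set t in Arc 2 Sigma | path_of t == pth a b c] = pth a b c.
  apply/setP=> t; have [a' [b' [c' ->]]] := tuple3_eta t.
  rewrite inE in_Arc2 //; apply/andP/idP => [[_ /eqP<-]|].
    by rewrite /path_of !inE eqxx.
  rewrite {1}/path_of rev_tuple3 !inE => /orP[]/eqP/tuple3_eq[-> -> ->].
    by rewrite abc.
  by rewrite path_of3_rev arc2_rev abc.
rewrite cards2 rev_tuple3; case: eqP => // /tuple3_eq[E _ _].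
by case/and3P: abc; rewrite E eqxx.
Qed.

(** If one 2-arc lies in a triangle then, by transitivity, all do. Being equal or adjacent to a
    given vertex then propagates along edges, and connectedness makes the graph complete. *)
Lemma complete5_or_girth : isomorphic Sigma (complete 5) \/ 4 <= girth Sigma.
Proof.
have [u uV] := vset_neq0.
have [/existsP[a /existsP[b /existsP[c /and3P[ab bc ac]]]]|no] :=
  boolP [exists a, exists b, exists c, [&& a ~ b, b ~ c & a ~ c]]; last first.
  right; apply: leq_girth => [|n C].
    (* The four neighbours of [u] ensure that the value of [girth] for an acyclic graph is large
       enough as well. *)
    have := max_card (mem (nbhd Sigma u)); rewrite Sigma_val4 //.
    by move/leq_trans; apply.
  case/and3P=> n3 /and3P[sC _ /subsetP sub] /isomorphicP[f [_ _ fadj]].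
  rewrite leq_eqVlt in n3; case/predU1P: n3 => // n3; subst n.
  have fS (i j : 'I_3) : i != j -> f i ~ f j.
    move=> ij; have: adj C (f i) (f j).
      rewrite fadj ?inE // adj_graph_of_rel ij /=.
      by case: i j ij => -[|[|[|//]]] i [[|[|[|//]]] j].
    by case/andP=> ne /sub fe; rewrite /adj ne.
  case/existsP: no; exists (f ord0); apply/existsP; exists (f (inord 1)).
  apply/existsP; exists (f ord_max).
  by rewrite !fS // -val_eqE /= ?inordK.
left; have tri p q r : arc2 p q r -> p ~ r.
  have abc : arc2 a b c by rewrite ab bc (adj_neq ac).
  by move=> /(arc2_trans abc)[x [xX <- _ <-]]; rewrite adj_act.
have all_adj p v : p \in V -> v \in V -> p != v -> p ~ v.
  move=> pV vV pv; pose Q w := w = p \/ p ~ w.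
  suff [E|//] : Q v by rewrite E eqxx in pv.
  apply: (@connect_ind _ _ Q _ _ _ _ (Sigma_connected pV vV)) => [|q r]; first by left.
  case=> [->|pq] qr; first by right.
  have [<-|pr] := eqVneq p r; first by left.
  by right; apply: (@tri p q r); rewrite pq qr.
have V5 : #|V| = 5.
  have -> : V = u |: nbhd Sigma u.
    apply/setP=> v; rewrite !inE; have [->|vu] := eqVneq v u; first by rewrite uV.
    apply/idP/idP => [vV|/adj_vsetr //]; by rewrite all_adj // eq_sym.
  by rewrite cardsU1 in_nbhd /adj eqxx /= Sigma_val4.
have [l l_inj lP] := enum_set V5.
have lV i : l i \in V by apply/lP; exists i.
apply: (@isomorphic_inv _ _ _ _ ord0 l).
- by move=> i j _ _; apply: l_inj.
- apply/setP=> v; apply/imsetP/idP => [[i _ ->] //|/lP[i ->]]; by exists i.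
move=> i j _ _; rewrite adj_graph_of_rel /= andbT.
have [->|ij] := eqVneq i j; first by rewrite /adj eqxx.
by rewrite all_adj // (inj_eq l_inj).
Qed.

(** * Self-paired orbits on 3-arcs and the two derived graphs *)

Section ThreeArcs.
Variable D : {set 4.-tuple T}.
Hypothesis D_orbit : self_paired_orbit X to Sigma D.

Local Notation DD a b c d := ([tuple a; b; c; d] \in D).
Local Notation gim := (gimel Sigma D).
Local Notation xi := (Xi Sigma D).

Lemma D_arc2 a b c d : DD a b c d -> arc2 a b c /\ arc2 b c d.
Proof.
case: D_orbit => /imsetP[t tA DE] _; rewrite DE => /orbitP[x xX].
have [a' [b' [c' [d' tE]]]] := tuple4_eta t.
rewrite tE /= tuple_act4E => /tuple4_eq[<- <- <- <-].
rewrite !adj_act // !act_eq; rewrite tE in_Arc3 // in tA.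
by case/and5P: tA => -> -> -> -> ->.
Qed.

Lemma D_act x a b c d : x \in X ->
  DD (to a x) (to b x) (to c x) (to d x) = DD a b c d.
Proof.
move=> xX; rewrite -tuple_act4E; case: D_orbit => /imsetP[t _ ->] _.
exact: (orbit_actr (tuple_action to 4)).
Qed.

Lemma D_rev a b c d : DD d c b a = DD a b c d.
Proof.
case: D_orbit => _ sp.
by apply/idP/idP => /sp; rewrite rev_tuple4.
Qed.

Lemma D_trans a b c d a' b' c' d' : DD a b c d -> DD a' b' c' d' ->
  exists x, [/\ x \in X, to a x = a', to b x = b', to c x = c' & to d x = d'].
Proof.
case: D_orbit => /imsetP[t _ DE] _; rewrite DE => tD tD'.
have := atransP2 (atrans_orbit (tuple_action to 4) X t) tD tD'.
by case=> x xX /=; rewrite tuple_act4E => /tuple4_eq[-> -> -> ->]; exists x.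
Qed.

Lemma D_neq0 : exists a b c d, DD a b c d.
Proof.
case: D_orbit => /imsetP[t _ ->] _.
have [a [b [c [d tE]]]] := tuple4_eta t.
by exists a, b, c, d; rewrite -tE orbit_refl.
Qed.

(* Its size is the k of the header. *)
Definition ext a b c := [set d | DD a b c d].

Lemma in_ext a b c d : (d \in ext a b c) = DD a b c d.
Proof. by rewrite inE. Qed.

Lemma ext_act x a b c : x \in X ->
  ext (to a x) (to b x) (to c x) = to^~ x @: ext a b c.
Proof.
move=> xX; apply/setP=> d; rewrite in_ext; apply/idP/imsetP => [Dd|[e]].
  exists (to d x^-1); last by rewrite actKV.
  by rewrite in_ext -(D_act _ _ _ _ xX) actKV.
by rewrite in_ext => De ->; rewrite D_act.
Qed.

Lemma ext_sub a b c : ext a b c \subset nbhd Sigma c :\ b.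
Proof.
apply/subsetP=> d; rewrite in_ext => /D_arc2[_ /and3P[_ cd bd]].
by rewrite !inE eq_sym bd.
Qed.

Lemma card_ext : exists k,
  [/\ 0 < k, k <= 3 & forall a b c, arc2 a b c -> #|ext a b c| = k].
Proof.
have [a [b [c [d abcd]]]] := D_neq0; have [abc bcd] := D_arc2 abcd.
exists #|ext a b c|; split.
- by apply/card_gt0P; exists d; rewrite in_ext.
- rewrite -(@card_nbhdD1 c b); first exact/subset_leq_card/ext_sub.
  by case/and3P: abc => _; rewrite adj_sym.
move=> a' b' c' abc'; have [x [xX <- <- <-]] := arc2_trans abc abc'.
by rewrite ext_act // card_imset //; apply: act_inj.
Qed.

(** Edges of [gim] are unordered, but self-pairing lets the 3-arc be read in the direction that
    meets [p] first. *)
Lemma gimel_adjP p q :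
  reflect (exists a b c d, [/\ DD a b c d, p = pth a b c & q = pth b c d])
          (adj gim p q).
Proof.
apply: (iffP idP) => [/andP[_]|[a [b [c [d [abcd -> ->]]]]]].
  rewrite inE => /existsP[a /existsP[b /existsP[c /existsP[d /andP[abcd]]]]].
  move/eqP/set2_eq=> [] [-> ->]; first by exists a, b, c, d.
  by exists d, c, b, a; rewrite D_rev (path_of3_rev b) (path_of3_rev a).
rewrite /adj inE; apply/andP; split.
  apply/eqP=> /path_of3_eq[bc _]; have [/and3P[_ /adj_neq]] := D_arc2 abcd.
  by rewrite bc eqxx.
apply/existsP; exists a; apply/existsP; exists b; apply/existsP; exists c.
by apply/existsP; exists d; rewrite abcd eqxx.
Qed.

(** A 2-path can be extended at either of its two ends. *)
Lemma gimel_adjE a b c p : adj gim (pth a b c) p ->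
  exists d, (DD a b c d /\ p = pth b c d) \/ (DD c b a d /\ p = pth b a d).
Proof.
case/gimel_adjP=> a' [b' [c' [d [abcd]]]] /path_of3_eq[bb] [] [aa cc] ->; subst.
  by exists d; left.
by exists d; right.
Qed.

Lemma gimel_simple : simple_graph gim.
Proof.
apply/forall_inP=> ed; rewrite inE.
case/existsP=> a /existsP[b /existsP[c /existsP[d /andP[abcd /eqP->]]]].
have: adj gim (pth a b c) (pth b c d) by apply/gimel_adjP; exists a, b, c, d.
move/adj_neq=> ne; rewrite cards2 ne /= subUset !sub1set /=.
by have [abc bcd] := D_arc2 abcd; rewrite !in_Path2 // abc bcd.
Qed.

Lemma Xi_adj t t1 s s1 : adj xi [tuple t; t1] [tuple s; s1] = DD t1 t s s1.
Proof.
apply/andP/idP => [[_]|D4].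
  rewrite inE => /existsP[a /existsP[b /existsP[c /existsP[d /andP[abcd]]]]].
  by move/eqP/set2_eq => [] [/tuple2_eq[-> ->] /tuple2_eq[-> ->]] //; rewrite D_rev.
split.
  apply/eqP=> /tuple2_eq[ts _]; have [/and3P[_ /adj_neq]] := D_arc2 D4.
  by rewrite ts eqxx.
rewrite inE; apply/existsP; exists t; apply/existsP; exists t1.
apply/existsP; exists s; apply/existsP; exists s1.
by rewrite D4 eqxx.
Qed.

Lemma Xi_simple : simple_graph xi.
Proof.
apply/forall_inP=> ed; rewrite inE.
case/existsP=> a /existsP[b /existsP[c /existsP[d /andP[abcd /eqP->]]]].
have: adj xi [tuple a; b] [tuple c; d] by rewrite Xi_adj.
move/adj_neq=> ne; rewrite cards2 ne /= subUset !sub1set /=.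
have [/and3P[ba _ _] /and3P[_ cd _]] := D_arc2 abcd.
by rewrite !in_Arc1 // cd adj_sym ba.
Qed.

Lemma PblockP p u :
  reflect (exists a c, arc2 a u c /\ p = pth a u c) (p \in Pblock Sigma u).
Proof.
rewrite inE; apply: (iffP andP) => [[pP /existsP[a /existsP[c /eqP pE]]]|].
  by exists a, c; split=> //; rewrite -in_Path2 // -pE.
case=> a [c [auc ->]]; split; first by rewrite in_Path2.
by apply/existsP; exists a; apply/existsP; exists c.
Qed.

Lemma in_Ablock u a b : ([tuple a; b] \in Ablock Sigma u) = (a == u) && (u ~ b).
Proof.
apply/imsetP/andP => [[c]|[/eqP-> ub]].
  by rewrite in_nbhd => uc /tuple2_eq[-> ->].
by exists b; rewrite ?in_nbhd.
Qed.

Lemma AblockP p u :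
  reflect (exists2 b, u ~ b & p = [tuple u; b]) (p \in Ablock Sigma u).
Proof.
apply: (iffP imsetP) => [[b]|[b ub ->]]; first by rewrite in_nbhd; exists b.
by exists b; rewrite ?in_nbhd.
Qed.

(** * Bipartite subgraphs between the blocks of adjacent vertices *)

Section Between.
Variables (tau sg : T) (l r : 'I_3 -> T) (R : rel 'I_3).
Hypothesis ts : tau ~ sg.
Hypotheses (l_inj : injective l) (r_inj : injective r).
Hypothesis lP : forall u, u \in nbhd Sigma tau :\ sg <-> exists i, u = l i.
Hypothesis rP : forall u, u \in nbhd Sigma sg :\ tau <-> exists i, u = r i.
Hypothesis lr : forall i j, DD (l i) tau sg (r j) = R i j.
Hypotheses (Rl : forall i, exists j, R i j) (Rr : forall j, exists i, R i j).

Let l_arc i : arc2 (l i) tau sg.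
Proof.
have: l i \in nbhd Sigma tau :\ sg by apply/lP; exists i.
by rewrite !inE => /andP[-> ]; rewrite adj_sym ts => ->.
Qed.

Let r_arc i : arc2 tau sg (r i).
Proof.
have: r i \in nbhd Sigma sg :\ tau by apply/rP; exists i.
by rewrite !inE eq_sym ts => /andP[-> ->].
Qed.

(** A 3-arc joining the two blocks has middle edge [tau], [sg], so only 2-paths through that edge
    matter. They are labelled by their outer ends, and for [xi] the same labels and the same [R]
    occur. *)
Lemma gimel_between :
  isomorphic (between gim (Pblock Sigma tau) (Pblock Sigma sg)) (bipartite_of R).
Proof.
have nts := adj_neq ts.
apply: (@between_isomorphic _ _ _ _ _ (fun i => pth (l i) tau sg)
         (fun j => pth tau sg (r j))) => //.
- apply/pred0P=> p /=; apply/negP => /andP[/PblockP[a [c [_ ->]]]].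
  by case/PblockP=> a' [c' [_ /path_of3_eq[E _]]]; rewrite E eqxx in nts.
- move=> i j /path_of3_eq[_] [] [] E1 E2; first exact: l_inj.
  by case/and3P: (l_arc i) => _ _; rewrite E1 eqxx.
- move=> i j /path_of3_eq[_] [] [] E1 E2; first exact: r_inj.
  by case/and3P: (r_arc i) => _ _; rewrite -E2 eqxx.
- by move=> i; apply/PblockP; exists (l i), sg.
- by move=> j; apply/PblockP; exists tau, (r j).
- move=> i j; rewrite -lr; apply/idP/idP => [/gimel_adjE[d]|ijD].
    case=> -[dD /path_of3_eq[E [] [E1 E2]]].
    + by rewrite E2.
    + by case/and3P: (r_arc j) => _ _; rewrite E2 eqxx.
    + by case/and3P: (l_arc i) => _ _; rewrite E eqxx.
    + by case/and3P: (l_arc i) => _ _; rewrite E eqxx.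
  by apply/gimel_adjP; exists (l i), tau, sg, (r j).
move=> p q /PblockP[a [c [aP ->]]] /PblockP[a' [c' [a'P ->]]].
case/gimel_adjP=> x [y [z [w [xD /path_of3_eq[E1 E1'] /path_of3_eq[E2 E2']]]]].
subst y z; have [/and3P[xt _ xs] /and3P[_ sw tw]] := D_arc2 xD.
have [i xi_] : exists i, x = l i.
  by apply/lP; rewrite !inE xs adj_sym.
have [j wj] : exists j, w = r j.
  by apply/rP; rewrite !inE eq_sym tw.
exists i, j; rewrite -xi_ -wj; split.
  by case: E1' => -[-> ->] //; rewrite path_of3_rev.
by case: E2' => -[-> ->] //; rewrite path_of3_rev.
Qed.

Lemma Xi_between :
  isomorphic (between xi (Ablock Sigma tau) (Ablock Sigma sg)) (bipartite_of R).
Proof.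
have nts := adj_neq ts.
apply: (@between_isomorphic _ _ _ _ _ (fun i => [tuple tau; l i])
         (fun j => [tuple sg; r j])) => //.
- apply/pred0P=> p /=; apply/negP => /andP[/AblockP[a _ ->]].
  by rewrite in_Ablock (negPf nts).
- by move=> i j /tuple2_eq[_ /l_inj].
- by move=> i j /tuple2_eq[_ /r_inj].
- by move=> i; rewrite in_Ablock eqxx adj_sym; case/and3P: (l_arc i).
- by move=> i; rewrite in_Ablock eqxx; case/and3P: (r_arc i).
- by move=> i j; rewrite Xi_adj lr.
move=> p q /AblockP[b tb ->] /AblockP[c sc ->]; rewrite Xi_adj => bD.
have [/and3P[_ _ bs] /and3P[_ _ tc]] := D_arc2 bD.
have [i ->] : exists i, b = l i by apply/lP; rewrite !inE bs.
have [j ->] : exists j, c = r j by apply/rP; rewrite !inE eq_sym tc.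
by exists i, j.
Qed.

End Between.

(** A 2-path determines its middle vertex, so an element preserving the block fixes [tau]. *)
Lemma stab_Pblock tau : tau \in V ->
  'N_X(Pblock Sigma tau | ((tuple_action to 3)^*)%act) = 'C_X[tau | to].
Proof.
move=> tV; apply/setP=> x; rewrite !(inE, in_setI); apply: andb_id2l => xX.
have [a ta _] := @exists_nbr tau [::] tV isT.
rewrite adj_sym in ta; have [c atc] := arc_extend ta.
apply/subsetP/subsetP => [/(_ (pth a tau c))|fix_t p].
  have ->: pth a tau c \in Pblock Sigma tau by apply/PblockP; exists a, c.
  move=> /(_ isT); rewrite inE path_of_act tuple_act3E.
  case/PblockP=> a' [c' [_ /path_of3_eq[E _]]].
  by move=> u; rewrite !inE => /eqP->; apply/eqP.
have tx : to tau x = tau by have := fix_t tau; rewrite !inE eqxx => /(_ isT)/eqP.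
case/PblockP=> u [w [utw ->]]; rewrite inE path_of_act tuple_act3E.
apply/PblockP; exists (to u x), (to w x); split; last by rewrite tx.
by rewrite -(arc2_act _ _ _ xX) tx in utw.
Qed.

Lemma stab_Ablock tau : tau \in V ->
  'N_X(Ablock Sigma tau | tuple_action to 2) = 'C_X[tau | to].
Proof.
move=> tV; apply/setP=> x; rewrite !(inE, in_setI); apply: andb_id2l => xX.
have [a ta _] := @exists_nbr tau [::] tV isT.
apply/subsetP/subsetP => [/(_ [tuple tau; a])|fix_t p].
  rewrite in_Ablock eqxx ta => /(_ isT).
  rewrite inE /= tuple_act2E in_Ablock => /andP[/eqP E _].
  by move=> u; rewrite !inE => /eqP->; apply/eqP.
have tx : to tau x = tau by have := fix_t tau; rewrite !inE eqxx => /(_ isT)/eqP.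
case/AblockP=> u tu ->; rewrite inE /= tuple_act2E in_Ablock tx eqxx.
by rewrite -(adj_act _ _ xX) tx in tu.
Qed.

Lemma path_of3_inj b c d d' : pth b c d = pth b c d' -> d = d'.
Proof. by case/path_of3_eq=> _ [] [] // <- ->. Qed.

(** * Valency and connectedness of the derived graphs *)

Section Valency.
Variable k : nat.
Hypothesis Hk : forall a b c, arc2 a b c -> #|ext a b c| = k.

(** There are [k] extensions at each end; the two families are disjoint because the middle vertices
    of the new 2-paths are [c] and [a]. *)
Lemma gimel_valency : has_valency gim (2 * k).
Proof.
move=> _ /(Path2P _ Sigma_simple)[a [b [c [abc ->]]]].
have -> : nbhd gim (pth a b c) =
    ((fun d => pth b c d) @: ext a b c) :|: ((fun d => pth b a d) @: ext c b a).
  apply/setP=> p; rewrite in_nbhd; apply/idP/setUP => [/gimel_adjE[d [] [dD ->]]|].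
  - by left; apply: imset_f; rewrite in_ext.
  - by right; apply: imset_f; rewrite in_ext.
  case=> /imsetP[d]; rewrite in_ext => dD ->; apply/gimel_adjP.
    by exists a, b, c, d.
  by exists c, b, a, d; rewrite (path_of3_rev a).
rewrite cardsU disjoint_setI0 ?cards0 ?subn0; last first.
  apply/pred0P=> p /=; apply/negP=> /andP[/imsetP[d _ ->] /imsetP[e _]].
  by case/path_of3_eq=> E _; case/and3P: abc => _ _; rewrite E eqxx.
rewrite !card_imset; try exact: path_of3_inj.
by rewrite !Hk ?addnn ?mul2n // arc2_rev.
Qed.

Lemma Xi_valency : has_valency xi (3 * k).
Proof.
move=> u; have [t [t1 ->]] := tuple2_eta u; rewrite in_Arc1 // => tt1.
rewrite (@card_fibers _ _ _ (nbhd Sigma t :\ t1) (fun w => thead w) k).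
- by rewrite (card_nbhdD1 tt1) mulnC.
- move=> v; have [s [s1 ->]] := tuple2_eta v; rewrite in_nbhd Xi_adj theadE.
  by case/D_arc2=> /and3P[_ ts ne] _; rewrite !inE eq_sym ne.
move=> s; rewrite !inE => /andP[ne ts].
have -> : [set u0 in nbhd xi [tuple t; t1] | thead u0 == s]
   = (fun s1 => [tuple s; s1]) @: ext t1 t s.
  apply/setP=> v; have [s' [s1 ->]] := tuple2_eta v.
  rewrite inE in_nbhd Xi_adj theadE; apply/andP/imsetP => [[dD /eqP<-]|].
    by exists s1; rewrite ?in_ext.
  by case=> s2; rewrite in_ext => sD /tuple2_eq[-> ->].
rewrite card_imset; last by move=> x y /tuple2_eq[].
by rewrite Hk // ts adj_sym tt1 eq_sym.
Qed.

Section Large.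
Hypothesis k2 : 1 < k.

Lemma ext_meet a a' t s : arc2 a t s -> arc2 a' t s ->
  exists2 b, DD a t s b & DD a' t s b.
Proof.
move=> ats a'ts; have st : s ~ t by rewrite adj_sym; case/and3P: ats.
have: ext a t s :|: ext a' t s \subset nbhd Sigma s :\ t.
  by rewrite subUset !ext_sub.
move/subset_leq_card; rewrite (card_nbhdD1 st) => le3.
have /card_gt0P[b] : 0 < #|ext a t s :&: ext a' t s|.
  rewrite -(ltn_add2l #|ext a t s :|: ext a' t s|) addn0 cardsUI !Hk //.
  exact: leq_ltn_trans le3 (leq_add k2 k2).
by rewrite inE !in_ext => /andP[]; exists b.
Qed.

Lemma ext_neq0 a t s : arc2 a t s -> exists b, DD a t s b.
Proof. by move=> ats; have [b] := ext_meet ats ats; exists b. Qed.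

(** Lifts connectedness of [Sigma] to a graph covered by sets attached to its vertices. The walks
    joining two points of one set may leave that set. *)
Lemma connect_vertexwise (U : finType) (G : graph U) (B : T -> {set U}) :
    (forall p, p \in vset G -> exists2 u, u \in V & p \in B u) ->
    (forall u p q, u \in V -> p \in B u -> q \in B u -> connect (adj G) p q) ->
    (forall u v, u ~ v -> exists p q, [/\ p \in B u, q \in B v & adj G p q]) ->
  connected_graph G.
Proof.
move=> B_cover B_conn B_step p q /B_cover[u uV pu] /B_cover[v vV qv].
have uv := Sigma_connected uV vV.
suff: v \in V -> forall q, q \in B v -> connect (adj G) p q by apply.
pose Q v := v \in V -> forall q, q \in B v -> connect (adj G) p q.
apply: (@connect_ind _ _ Q _ _ _ _ uv) => [_ q' q'u|x y IH xy yV q' q'y].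
  exact: B_conn pu q'u.
have [p1 [q1 [p1x q1y pq1]]] := B_step _ _ xy.
apply: connect_trans (IH (adj_vsetl xy) _ p1x) _.
exact: connect_trans (connect1 pq1) (B_conn _ _ _ yV q1y q'y).
Qed.

Lemma gimel_connected : connected_graph gim.
Proof.
(* One end of a 2-path can be exchanged while the other is kept, by passing through a common
   extension. *)
have swap a a' t s : arc2 a t s -> arc2 a' t s ->
    connect (adj gim) (pth a t s) (pth a' t s).
  move=> ats a'ts; have [b Da Da'] := ext_meet ats a'ts.
  apply: (@connect_trans _ _ (pth t s b)); apply: connect1.
    by apply/gimel_adjP; exists a, t, s, b.
  by rewrite adj_sym; apply/gimel_adjP; exists a', t, s, b.
apply: (@connect_vertexwise _ _ (Pblock Sigma)).
- move=> p /(Path2P _ Sigma_simple)[a [b [c [abc ->]]]].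
  exists b; first by case/and3P: abc => _ /adj_vsetl.
  by apply/PblockP; exists a, c.
- move=> t p q _ /PblockP[a [c [atc ->]]] /PblockP[a' [c' [a'tc' ->]]].
  (* In general [a] is exchanged for [a'] and then [c] for [c']. When [a' = c] the intermediate
     2-path would degenerate, but then one exchange is enough. *)
  have [E|a'c] := eqVneq a' c.
    by subst a'; rewrite (path_of3_rev c'); apply: swap; rewrite // arc2_rev.
  have a'tc : arc2 a' t c.
    by rewrite a'c; case/and3P: atc => _ -> _; case/and3P: a'tc' => ->.
  apply: connect_trans (swap _ _ _ _ atc a'tc) _.
  by rewrite -(path_of3_rev a' t c) -(path_of3_rev a' t c'); apply: swap; rewrite arc2_rev.
move=> t s ts; have st := ts; rewrite adj_sym in st.
have [a] := arc_extend st; rewrite arc2_rev => ats.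
have [b Db] := ext_neq0 ats; have [_ tsb] := D_arc2 Db.
exists (pth a t s), (pth t s b); split.
- by apply/PblockP; exists a, s.
- by apply/PblockP; exists t, b.
by apply/gimel_adjP; exists a, t, s, b.
Qed.

Lemma Xi_connected : connected_graph xi.
Proof.
apply: (@connect_vertexwise _ _ (Ablock Sigma)).
- move=> p; have [t [a ->]] := tuple2_eta p; rewrite in_Arc1 // => ta.
  by exists t; rewrite ?in_Ablock ?eqxx // (adj_vsetl ta).
- move=> t p q tV /AblockP[a ta ->] /AblockP[b tb ->].
  (* Any neighbour [s] outside [a], [b] will do: a common extension [c] of (a, t, s) and (b, t, s)
     gives an arc (s, c) adjacent to both given arcs. *)
  have [s ts] := @exists_nbr t [:: a; b] tV isT.
  rewrite !inE negb_or => /andP[sa sb].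
  have ats : arc2 a t s by rewrite adj_sym ta ts eq_sym.
  have bts : arc2 b t s by rewrite adj_sym tb ts eq_sym.
  have [c Da Db] := ext_meet ats bts.
  apply: (@connect_trans _ _ [tuple s; c]); apply: connect1; rewrite ?Xi_adj //.
  by rewrite D_rev.
move=> t s ts; have st := ts; rewrite adj_sym in st.
have [a] := arc_extend st; rewrite arc2_rev => ats.
have [b Db] := ext_neq0 ats; have [_ /and3P[_ sb _]] := D_arc2 Db.
exists [tuple t; a], [tuple s; b]; rewrite !in_Ablock !eqxx sb Xi_adj Db.
by rewrite adj_sym; case/and3P: ats => ->.
Qed.

End Large.
End Valency.

(** * Arc-transitivity and arc-regularity of the derived graphs *)

Local Notation toA := (tuple_action to 2).
Local Notation toP := ((tuple_action to 3)^*)%act.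

Lemma pth_act a b c x : toP (pth a b c) x = pth (to a x) (to b x) (to c x).
Proof. by rewrite path_of_act tuple_act3E. Qed.

Lemma gimel_arc_transitive : arc_transitive X toP gim 1.
Proof.
have [a [b [c [d Da]]]] := D_neq0; have [abc bcd] := D_arc2 Da.
split.
  apply: (@atransI _ _ _ _ _ (pth a b c)); first by rewrite in_Path2.
    move=> _ /(Path2P _ Sigma_simple)[a' [b' [c' [abc' ->]]]].
    have [x [xX ax bx cx]] := arc2_trans abc abc'.
    by exists x; rewrite // pth_act ax bx cx.
  move=> x _ xX /(Path2P _ Sigma_simple)[a' [b' [c' [abc' ->]]]].
  by rewrite pth_act in_Path2 // arc2_act.
apply: (@atransI _ _ _ _ _ [tuple pth a b c; pth b c d]).
- rewrite in_Arc1 ?gimel_simple //; apply/gimel_adjP; by exists a, b, c, d.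
- move=> t; have [p [q ->]] := tuple2_eta t.
  rewrite in_Arc1 ?gimel_simple // => /gimel_adjP[a' [b' [c' [d' [Da' -> ->]]]]].
  have [x [xX ax bx cx dx]] := D_trans Da Da'.
  by exists x => //; rewrite [LHS]tuple_act2E !pth_act ax bx cx dx.
move=> x t xX; have [p [q ->]] := tuple2_eta t.
rewrite [tuple_action _ _ _ _]tuple_act2E !in_Arc1 ?gimel_simple //.
case/gimel_adjP=> a' [b' [c' [d' [Da' -> ->]]]]; rewrite !pth_act.
apply/gimel_adjP; exists (to a' x), (to b' x), (to c' x), (to d' x).
by rewrite D_act.
Qed.

Lemma Xi_arc_transitive : arc_transitive X toA xi 1.
Proof.
have [a [b [c [d Da]]]] := D_neq0; have [abc bcd] := D_arc2 Da.
have ab : a ~ b by case/and3P: abc.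
split.
  apply: (@atransI _ _ _ _ _ [tuple a; b]); first by rewrite in_Arc1.
    move=> t; have [a' [b' ->]] := tuple2_eta t; rewrite in_Arc1 // => ab'.
    have [x [xX ax bx]] := arc_trans ab ab'.
    by exists x; rewrite //= tuple_act2E ax bx.
  move=> x t xX; have [a' [b' ->]] := tuple2_eta t; rewrite in_Arc1 // => ab'.
  by rewrite /= tuple_act2E in_Arc1 // adj_act.
apply: (@atransI _ _ _ _ _ [tuple [tuple b; a]; [tuple c; d]]).
- by rewrite in_Arc1 ?Xi_simple // Xi_adj.
- move=> t; have [p [q ->]] := tuple2_eta t.
  have [b' [a' ->]] := tuple2_eta p; have [c' [d' ->]] := tuple2_eta q.
  rewrite in_Arc1 ?Xi_simple // Xi_adj => Da'.
  have [x [xX ax bx cx dx]] := D_trans Da Da'.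
  by exists x => //; rewrite [LHS]tuple_act2E /= !tuple_act2E ax bx cx dx.
move=> x t xX; have [p [q ->]] := tuple2_eta t.
have [b' [a' ->]] := tuple2_eta p; have [c' [d' ->]] := tuple2_eta q.
rewrite [tuple_action _ _ _ _]tuple_act2E /= !tuple_act2E.
by rewrite !in_Arc1 ?Xi_simple // !Xi_adj D_act.
Qed.

(** As [D] is an orbit, this amounts to regularity of X on [D]. *)
Definition semiregular_D := forall a b c d x, DD a b c d -> x \in X ->
  to a x = a -> to b x = b -> to c x = c -> to d x = d -> x = 1.

(** An arc of [gim] recovers its 3-arc together with the direction: the middle vertices come in
    order, and an element fixing both cannot flip either 2-path. *)
Lemma gimel_arc_regular : arc_regular X toP gim 1 <-> semiregular_D.
Proof.
split=> [[_ reg] a b c d x Da xX ax bx cx dx|reg].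
  have: x \in 'C_X[[tuple pth a b c; pth b c d] | tuple_action toP 2].
    rewrite inE xX; apply/astab1P; rewrite [LHS]tuple_act2E.
    by rewrite !pth_act ax bx cx dx.
  rewrite reg; first by move/set1P.
  rewrite in_Arc1 ?gimel_simple //; apply/gimel_adjP; by exists a, b, c, d.
split; first exact: gimel_arc_transitive.
move=> t; have [p [q ->]] := tuple2_eta t.
rewrite in_Arc1 ?gimel_simple // => /gimel_adjP[a [b [c [d [Da -> ->]]]]].
apply/eqP; rewrite eqEsubset sub1G andbT; apply/subsetP=> x.
rewrite inE => /andP[xX /astab1P].
rewrite [LHS]tuple_act2E !pth_act.
move/tuple2_eq => [/path_of3_eq[bx E1] /path_of3_eq[cx E2]].
have [/and3P[_ _ ac] /and3P[_ _ bd]] := D_arc2 Da.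
case: E1 => -[ax cx']; last by rewrite -cx' cx eqxx in ac.
case: E2 => -[bx' dx]; last by rewrite -bx' bx eqxx in bd.
by rewrite (reg _ _ _ _ _ Da xX ax bx cx dx).
Qed.

Lemma Xi_arc_regular : semiregular_D -> arc_regular X toA xi 1.
Proof.
move=> reg; split; first exact: Xi_arc_transitive.
move=> t; have [p [q ->]] := tuple2_eta t.
have [b [a ->]] := tuple2_eta p; have [c [d ->]] := tuple2_eta q.
rewrite in_Arc1 ?Xi_simple // Xi_adj => Da.
apply/eqP; rewrite eqEsubset sub1G andbT; apply/subsetP=> x.
rewrite inE => /andP[xX /astab1P].
rewrite [LHS]tuple_act2E /= !tuple_act2E.
move/tuple2_eq => [/tuple2_eq[bx ax] /tuple2_eq[cx dx]].
by rewrite (reg _ _ _ _ _ Da xX ax bx cx dx).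
Qed.

(** Two kinds of 2-arcs exist: the outer vertices extend the central 2-path at the same end or at
    opposite ends. X preserves the kind, since it shows in whether the outer 2-paths have equal
    middle vertices. *)
Lemma gimel_not_2arc_transitive k : 1 < k ->
  (forall a b c, arc2 a b c -> #|ext a b c| = k) -> ~ arc_transitive X toP gim 2.
Proof.
move=> k2 Hk [_ tr].
have [a [b [c [d Da]]]] := D_neq0; have [abc bcd] := D_arc2 Da.
have [d' Dd' dd'] : exists2 d', DD a b c d' & d' != d.
  have: 0 < #|ext a b c :\ d|.
    by have := cardsD1 d (ext a b c); rewrite in_ext Da Hk // => E; rewrite E in k2.
  by case/card_gt0P=> d'; rewrite !inE => /andP[]; exists d'.
have [e De] : exists e, DD c b a e.
  by apply: (ext_neq0 Hk k2); rewrite arc2_rev.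
have ac : a != c by case/and3P: abc.
have adj1 f : DD a b c f -> adj gim (pth a b c) (pth b c f).
  by move=> Df; apply/gimel_adjP; exists a, b, c, f.
have adj2 : adj gim (pth a b c) (pth b a e).
  by apply/gimel_adjP; exists c, b, a, e; rewrite (path_of3_rev a).
have A1 : [tuple pth b c d; pth a b c; pth b c d'] \in Arc 2 gim.
  rewrite in_Arc2 ?gimel_simple // adj1 // adj_sym adj1 //=.
  by apply: contraNneq dd' => /path_of3_inj->.
have A2 : [tuple pth b c d; pth a b c; pth b a e] \in Arc 2 gim.
  rewrite in_Arc2 ?gimel_simple // adj2 // adj_sym adj1 //=.
  by apply: contraNneq ac => /path_of3_eq[->].
have [x xX] := atransP2 tr A1 A2; rewrite [RHS]tuple_act3E !pth_act.
case/tuple3_eq=> /path_of3_eq[cx _] _ /path_of3_eq[cx' _].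
by rewrite cx' -cx eqxx in ac.
Qed.

(** The invariant is whether the two outer arcs start at the same vertex of [Sigma]. Both kinds
    occur, the first because [k > 1]. *)
Lemma Xi_not_2arc_transitive k : 1 < k ->
  (forall a b c, arc2 a b c -> #|ext a b c| = k) -> ~ arc_transitive X toA xi 2.
Proof.
move=> k2 Hk [_ tr].
have [t1 [t [s [s1 Da]]]] := D_neq0; have [abc bcd] := D_arc2 Da.
have [s2 Dd' dd'] : exists2 d', DD t1 t s d' & d' != s1.
  have: 0 < #|ext t1 t s :\ s1|.
    by have := cardsD1 s1 (ext t1 t s); rewrite in_ext Da Hk // => E; rewrite E in k2.
  by case/card_gt0P=> d'; rewrite !inE => /andP[]; exists d'.
case/and3P: abc => t1t ts t1s.
have [r tr_ ] := @exists_nbr t [:: t1; s] (adj_vsetl ts) isT.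
rewrite !inE negb_or => /andP[rt1 rs].
have t1tr : arc2 t1 t r by rewrite t1t tr_ eq_sym.
have [r1 Dr] := ext_neq0 Hk k2 t1tr.
have A1 : [tuple [tuple s; s1]; [tuple t; t1]; [tuple s; s2]] \in Arc 2 xi.
  rewrite in_Arc2 ?Xi_simple // adj_sym !Xi_adj Da Dd' /=.
  by apply: contraNneq dd' => /tuple2_eq[_ ->].
have A2 : [tuple [tuple s; s1]; [tuple t; t1]; [tuple r; r1]] \in Arc 2 xi.
  rewrite in_Arc2 ?Xi_simple // adj_sym !Xi_adj Da Dr /=.
  by apply: contraNneq rs => /tuple2_eq[->].
have [x xX] := atransP2 tr A1 A2; rewrite [RHS]tuple_act3E /= !tuple_act2E.
case/tuple3_eq=> /tuple2_eq[sx _] _ /tuple2_eq[rx _].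
by rewrite rx -sx eqxx in rs.
Qed.

Lemma D_full : (forall a b c, arc2 a b c -> #|ext a b c| = 3) -> D = Arc 3 Sigma.
Proof.
move=> H3; apply/setP=> t; have [a [b [c [d ->]]]] := tuple4_eta t.
rewrite in_Arc3 //; apply/idP/idP.
  by case/D_arc2=> /and3P[-> -> ->] /and3P[_ -> ->].
case/and5P=> ab bc cd ac bd.
have abc : arc2 a b c by rewrite ab bc.
have /eqP E : ext a b c == nbhd Sigma c :\ b.
  by rewrite eqEcard ext_sub H3 // card_nbhdD1 // adj_sym.
by rewrite -in_ext E !inE eq_sym bd.
Qed.

Lemma arc3_transitive : D = Arc 3 Sigma -> arc_transitive X to Sigma 3.
Proof.
move=> DE; split; first by case: X_2arc.
by rewrite -DE; case: D_orbit => /imsetP[t _ ->] _; apply: atrans_orbit.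
Qed.

(** * The case of a unique extension *)

Section Matching.
Hypothesis H1 : forall a b c, arc2 a b c -> #|ext a b c| = 1%N.

Lemma D_uniq a b c d d' : DD a b c d -> DD a b c d' -> d = d'.
Proof.
move=> Dd Dd'; have [abc _] := D_arc2 Dd.
have /eqP/cards1P[e E] := H1 abc.
by move: Dd Dd'; rewrite -!in_ext E !inE => /eqP-> /eqP->.
Qed.

Lemma D_ex a b c : arc2 a b c -> exists d, DD a b c d.
Proof.
by move=> /H1/eqP/cards1P[d E]; exists d; rewrite -in_ext E inE.
Qed.

Lemma fix_nbhd_triv x u : x \in X -> u \in V -> to u x = u ->
  (forall v, u ~ v -> to v x = v) -> x = 1.
Proof.
move=> xX uV ux nx; have /faithfulP F := X_faithful; apply: F => // v vV.
pose Q w := to w x = w /\ forall v, w ~ v -> to v x = v.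
suff [] : Q v by [].
apply: (@connect_ind _ _ Q _ _ _ _ (Sigma_connected uV vV)) => //.
move=> p q [px pn] pq; split; first exact: pn.
move=> r qr; have [<-//|pr] := eqVneq p r.
(* [s] continues [r], [q] beyond [p]. It is a neighbour of [p], hence fixed, and the reversed 3-arc
   determines [r] from [s], [p], [q]. *)
have [s Ds] : exists s, DD r q p s.
  by apply: D_ex; rewrite adj_sym qr adj_sym pq eq_sym.
have sx : to s x = s by apply: pn; have [_ /and3P[_ ->]] := D_arc2 Ds.
rewrite D_rev in Ds; apply: D_uniq (Ds).
by rewrite -(D_act _ _ _ _ xX) sx px pn in Ds.
Qed.

(** The action on the four neighbours as permutations of their labels; it is faithful by
    [fix_nbhd_triv]. *)
Lemma nbhd_repr tau (l : 'I_4 -> T) : tau \in V -> injective l ->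
    (forall u, u \in nbhd Sigma tau <-> exists i, u = l i) ->
  exists rho : {morphism 'C_X[tau | to] >-> {perm 'I_4}},
    'injm rho /\ {in 'C_X[tau | to], forall x i, l (rho x i) = to (l i) x}.
Proof.
move=> tV l_inj lP.
pose rho x := odflt 1 [pick p : {perm 'I_4} | [forall i, l (p i) == to (l i) x]].
have rhoE : {in 'C_X[tau | to], forall x i, l (rho x i) = to (l i) x}.
  move=> x; rewrite inE => /andP[xX /astab1P tx] i; rewrite /rho.
  case: pickP => [q /forallP/(_ i)/eqP //|no].
  have im j : exists j', to (l j) x = l j'.
    by apply/lP; rewrite in_nbhd -tx adj_act // -in_nbhd; apply/lP; exists j.
  pose f j := odflt j [pick j' | l j' == to (l j) x].
  have fE j : l (f j) = to (l j) x.
    rewrite /f; case: pickP => [j' /eqP//|nj]; have [j' E] := im j.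
    by have := nj j'; rewrite E eqxx.
  have f_inj : injective f.
    by move=> j j' E; apply/l_inj/(act_inj to x); rewrite -!fE E.
  have /forallP[] := no (perm f_inj); move=> j; by rewrite permE fE.
have rhoM : {in 'C_X[tau | to] &, {morph rho : x y / x * y}}.
  move=> x y xC yC; apply/permP=> i; apply: l_inj.
  by rewrite rhoE ?groupM // permM !rhoE // actM.
exists (Morphism rhoM); split=> //.
apply/injmP=> x y xC yC /= E.
have xyC : x * y^-1 \in 'C_X[tau | to] by rewrite groupM ?groupV.
apply/eqP; rewrite eq_mulgV1; apply/eqP.
move: (xyC); rewrite inE => /andP[xyX /astab1P xyt].
apply: (fix_nbhd_triv xyX tV xyt) => v; rewrite -in_nbhd => /lP[i ->].
have E2 : to (l i) x = to (l i) y by rewrite -!rhoE // E.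
by rewrite actM E2 actK.
Qed.

Definition regular2 := forall a b c x, arc2 a b c -> x \in X ->
  to a x = a -> to b x = b -> to c x = c -> x = 1.

Definition irregular2 := forall a b c, arc2 a b c ->
  exists x, [/\ x \in X, x != 1, to a x = a, to b x = b & to c x = c].

(** [irregular2] is formally stronger than the negation of [regular2]; the gap closes because
    stabilisers of 2-arcs are conjugate in X. *)
Lemma regular2_dec : regular2 \/ irregular2.
Proof.
have [a [b [c [d Da]]]] := D_neq0; have [abc _] := D_arc2 Da.
have [/exists_inP[x xX /and4P[x1 /eqP ax /eqP bx /eqP cx]]|no] :=
  boolP [exists x in X, [&& x != 1, to a x == a, to b x == b & to c x == c]].
  right=> a' b' c' abc'; have [y [yX ay by_ cy]] := arc2_trans abc abc'.
  exists (x ^ y); split; rewrite ?groupJ ?conjg_eq1 //.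
  - by rewrite -ay -actCJ ax.
  - by rewrite -by_ -actCJ bx.
  - by rewrite -cy -actCJ cx.
left=> a' b' c' x abc' xX ax bx cx.
have [y [yX ay by_ cy]] := arc2_trans abc' abc.
apply/eqP; apply: contraNT no => x1; apply/exists_inP; exists (x ^ y).
  by rewrite groupJ.
by rewrite conjg_eq1 x1 -ay -by_ -cy -!actCJ ax bx cx !eqxx.
Qed.

(** * The vertex stabiliser: alternating or symmetric of degree 4 *)

Section Stabiliser.
Variable tau : T.
Hypothesis tV : tau \in V.
Local Notation H := 'C_X[tau | to].

Lemma card_arc_stab sg : tau ~ sg -> #|H| = (4 * #|'C_H[sg | to]|)%N.
Proof.
move=> ts; rewrite -(card_orbit_stab to _ sg); congr muln.
rewrite -(Sigma_val4 tV); apply: eq_card => u; rewrite in_nbhd.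
apply/orbitP/idP => [[x]|tu].
  by rewrite inE => /andP[xX /astab1P tx] <-; rewrite -{1}tx adj_act.
have [x [xX tx sx]] := arc_trans ts tu.
by exists x => //; rewrite inE xX; apply/astab1P.
Qed.

Lemma card_arc2_stab sg a : tau ~ sg -> tau ~ a -> a != sg ->
  #|'C_H[sg | to]| = (3 * #|'C_('C_H[sg | to])[a | to]|)%N.
Proof.
move=> ts ta as_; rewrite -(card_orbit_stab to _ a); congr muln.
rewrite -(card_nbhdD1 ts); apply: eq_card => u; rewrite !inE.
apply/orbitP/andP => [[x]|[us tu]].
  case/setIP=> /setIP[xX /astab1P tx] /astab1P sx <-.
  by rewrite -{1}sx act_eq as_ -{1}tx adj_act.
have sta : arc2 sg tau a by rewrite adj_sym ts ta eq_sym.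
have stu : arc2 sg tau u by rewrite adj_sym ts tu eq_sym.
have [x [xX sx tx ax]] := arc2_trans sta stu.
by exists x; first exact: mem_stab1 (mem_stab1 xX tx) sx.
Qed.

(** Orbit counting gives order 4 * 3 times that of a non-trivial 2-arc stabiliser, hence at least
    24, and the group embeds in the symmetric group of order 24. *)
Lemma stab_Sym : irregular2 -> H \isog 'Sym_('I_4).
Proof.
move=> irr.
have [l l_inj lP] := enum_set (Sigma_val4 tV).
have [rho [rho_inj rhoE]] := nbhd_repr tV l_inj lP.
have [sg ts _] := @exists_nbr tau [::] tV isT.
have [a ta] := @exists_nbr tau [:: sg] tV isT; rewrite inE => as_.
have ats : arc2 a tau sg by rewrite adj_sym ta ts.
have [x [xX x1 ax tx sx]] := irr _ _ _ ats.
have le24 : 24 <= #|H|.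
  rewrite (card_arc_stab ts) (card_arc2_stab ts ta as_) mulnA.
  rewrite (@leq_mul 12 2 12) // cardG_gt1; apply/trivgPn; exists x => //.
  exact: mem_stab1 (mem_stab1 (mem_stab1 xX tx) sx) ax.
have <- : rho @* H = 'Sym_('I_4).
  apply/eqP; rewrite eqEcard card_Sym card_ord subsetT /=.
  by rewrite card_injm.
exact: (sub_isog (subxx H) rho_inj).
Qed.

(* An element of the stabiliser with a fixed neighbour has order dividing 3, so
   it is even; every element is a product of two such elements. *)
Lemma stab_Alt : regular2 -> H \isog 'Alt_('I_4).
Proof.
move=> reg.
have [l l_inj lP] := enum_set (Sigma_val4 tV).
have [rho [rho_inj rhoE]] := nbhd_repr tV l_inj lP.
have card3 sg : tau ~ sg -> #|'C_H[sg | to]| = 3.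
  move=> ts; have [a ta] := @exists_nbr tau [:: sg] tV isT; rewrite inE => as_.
  have ats : arc2 a tau sg by rewrite adj_sym ta ts.
  rewrite (card_arc2_stab ts ta as_); suff -> : 'C_('C_H[sg | to])[a | to] = 1.
    by rewrite cards1.
  apply/trivgP/subsetP=> x; case/setIP=> /setIP[/setIP[xX /astab1P tx] /astab1P sx] /astab1P ax.
  by rewrite (reg _ _ _ _ ats xX ax tx sx).
have even3 x sg : tau ~ sg -> x \in 'C_H[sg | to] -> odd_perm (rho x) = false.
  move=> ts xC; have xH : x \in H by case/setIP: xC.
  have := expg_cardG xC; rewrite card3 // => x3.
  have := odd_perm1 'I_4; rewrite -(morph1 rho) -x3 morphX //.
  by rewrite !expgS expg0 mulg1 !odd_permM; case: (odd_perm _).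
have sub : rho @* H \subset 'Alt_('I_4).
  apply/subsetP=> _ /morphimP[x xH _ ->]; rewrite Alt_even.
  have nl i : tau ~ l i by rewrite -in_nbhd; apply/lP; exists i.
  move: (xH); rewrite inE => /andP[xX /astab1P tx].
  set u := l ord0; set v := to u x.
  have tu : tau ~ u by apply: nl.
  have tv : tau ~ v by rewrite -tx adj_act.
  (* As [c] avoids both [u] and its image [v], some [y] fixes [tau] and [c] and takes [v] back to
     [u]; then [x * y] fixes [u]. *)
  have [c tc] := @exists_nbr tau [:: u; v] tV isT.
  rewrite !inE negb_or => /andP[cu cv].
  have ctv : arc2 c tau v by rewrite adj_sym tc tv.
  have ctu : arc2 c tau u by rewrite adj_sym tc tu.
  have [y [yX cy ty vy]] := arc2_trans ctv ctu.
  have yH : y \in H by rewrite inE yX; apply/astab1P.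
  have yC : y \in 'C_H[c | to] by rewrite inE yH; apply/astab1P.
  have xyC : x * y \in 'C_H[u | to].
    by rewrite inE groupM //; apply/astab1P; rewrite actM.
  have := even3 _ _ tu xyC; rewrite morphM // odd_permM (even3 _ _ tc yC).
  by rewrite addbF => ->.
have <- : rho @* H = 'Alt_('I_4).
  apply/eqP; rewrite eqEcard sub card_injm //.
  have [sg ts' _] := @exists_nbr tau [::] tV isT.
  rewrite (card_arc_stab ts') card3 // -(leq_pmul2l (isT : 0 < 2)).
  by rewrite card_Alt card_ord.
exact: (sub_isog (subxx H) rho_inj).
Qed.

End Stabiliser.

(* [g] shifts by one step the walk along [D] that starts with the 2-arc
   (a, a g, a g^2). *)
Definition rotary a g :=
  (g \in X) && DD a (to a g) (to a (g ^+ 2)) (to a (g ^+ 3)).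

Local Notation cyc := (orbit_cycle to).
Local Notation orb g a := (orbit to <[g]> a).

(** * Rotary pairs and the cycles they trace *)

Lemma rotary_ex a b c : arc2 a b c ->
  exists g, [/\ rotary a g, to a g = b & to a (g ^+ 2) = c].
Proof.
move=> abc; have [d Dd] := D_ex abc; have [_ bcd] := D_arc2 Dd.
have [g [gX ag bg cg]] := arc2_trans abc bcd.
have g2 : to a (g ^+ 2) = c by rewrite expgS expg1 actM ag.
exists g; split=> //; rewrite /rotary gX ag g2.
by rewrite (expgSr g 2) actM g2 cg.
Qed.

Lemma rotary_arc2 a g : rotary a g -> arc2 a (to a g) (to a (g ^+ 2)).
Proof. by case/andP=> _ /D_arc2[]. Qed.

Lemma rotary_X a g : rotary a g -> g \in X.
Proof. by case/andP. Qed.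

Lemma rotary_D a g : rotary a g -> DD a (to a g) (to a (g ^+ 2)) (to a (g ^+ 3)).
Proof. by case/andP. Qed.

Lemma act_conjX a g x i : to (to a x) ((g ^ x) ^+ i) = to (to a (g ^+ i)) x.
Proof. by rewrite -conjXg -actCJ. Qed.

Lemma rotary_act a g x : x \in X -> rotary a g -> rotary (to a x) (g ^ x).
Proof.
move=> xX /andP[gX Da]; rewrite /rotary groupJ // -{1}(expg1 (g ^ x)) !act_conjX.
by rewrite D_act.
Qed.

(** Self-pairing reverses the 3-arc, and the third power of [g^-1] then moves it so that it starts
    at [a] again. *)
Lemma rotary_inv a g : rotary a g -> rotary a g^-1.
Proof.
case/andP=> gX Da; rewrite /rotary groupV gX /= -D_rev.
have E i : i <= 3 -> to (to a (g ^+ i)) (g^-1 ^+ 3) = to a (g^-1 ^+ (3 - i)).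
  move=> i3; rewrite -{1}(subnKC i3) expgD actM; congr (to _ _).
  by rewrite expgVn actK.
have hX : g^-1 ^+ 3 \in X by rewrite groupX ?groupV.
rewrite -(D_act _ _ _ _ hX) in Da.
have E1 : to (to a g) (g^-1 ^+ 3) = to a (g^-1 ^+ 2) := E 1%N isT.
have E2 : to (to a (g ^+ 2)) (g^-1 ^+ 3) = to a g^-1 := E 2 isT.
have E3 : to (to a (g ^+ 3)) (g^-1 ^+ 3) = a by rewrite (E 3) // act1.
by rewrite E1 E2 E3 in Da.
Qed.

Lemma rotary_shift a g u : rotary a g -> u \in orb g a -> rotary u g.
Proof.
move=> Ra /orbit_cycleP[i ->]; have gX := rotary_X Ra.
have gJ : g ^ (g ^+ i) = g by rewrite conjgE (commuteX i (commute_refl g)) mulKg.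
by have := rotary_act (groupX i gX) Ra; rewrite gJ.
Qed.

(** Stated for arbitrary sequences because it is also applied to images of the walk of [g] under
    other elements of X. *)
Lemma walk_uniq (s s' : nat -> T) :
    (forall i, DD (s i) (s i.+1) (s i.+2) (s i.+3)) ->
    (forall i, DD (s' i) (s' i.+1) (s' i.+2) (s' i.+3)) ->
    s 0 = s' 0 -> s 1%N = s' 1%N -> s 2 = s' 2 -> forall i, s i = s' i.
Proof.
move=> Ds Ds' e0 e1 e2 i.
suff: [/\ s i = s' i, s i.+1 = s' i.+1 & s i.+2 = s' i.+2] by case.
elim: i => // i [E0 E1 E2]; split=> //.
apply: D_uniq (Ds i) _; rewrite E0 E1 E2; exact: Ds'.
Qed.

Lemma rotary_walk a g : rotary a g ->
  forall i, DD (to a (g ^+ i)) (to a (g ^+ i.+1)) (to a (g ^+ i.+2)) (to a (g ^+ i.+3)).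
Proof.
move=> Ra i; have := rotary_shift Ra (mem_orbit to a (mem_cycle g i)).
by case/andP=> _; rewrite -!actM -expgSr -!expgD !addnS addn0.
Qed.

Lemma rotary_ext a g a' g' : rotary a g -> rotary a' g' -> a = a' ->
    to a g = to a' g' -> to a (g ^+ 2) = to a' (g' ^+ 2) ->
  forall i, to a (g ^+ i) = to a' (g' ^+ i).
Proof.
move=> Ra Ra' e0 e1 e2.
by apply: (walk_uniq (rotary_walk Ra) (rotary_walk Ra')); rewrite ?act1.
Qed.

Lemma rotary_simple a g : rotary a g -> simple_graph (cyc a g).
Proof.
move=> Ra; apply/forall_inP=> _ /imsetP[u uO ->].
have /rotary_arc2/and3P[uv _ _] := rotary_shift Ra uO.
by rewrite cards2 (adj_neq uv) subUset !sub1set /= orbit_cycle_actr uO.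
Qed.

Lemma rotary_subgraph a g : rotary a g -> subgraph (cyc a g) Sigma.
Proof.
move=> Ra; rewrite /subgraph rotary_simple //=; apply/andP; split.
  apply/subsetP=> u /(rotary_shift Ra)/rotary_arc2/and3P[uv _ _].
  exact: adj_vsetl uv.
apply/subsetP=> _ /imsetP[u uO ->].
by have /rotary_arc2/and3P[/andP[_ ->]] := rotary_shift Ra uO.
Qed.

Lemma rotary_Arc2 a g u v w : rotary a g ->
  [tuple u; v; w] \in Arc 2 (cyc a g) <->
  u \in orb g a /\ exists2 g', g' = g \/ g' = g^-1 &
    v = to u g' /\ w = to u (g' ^+ 2).
Proof.
move=> Ra; rewrite in_Arc2 ?rotary_simple //; split.
  rewrite !adj_orbit_cycle => /and3P[/and3P[_ uO uv] /and3P[_ _ vw] uw].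
  split=> //; case/orP: uv => /eqP E1; case/orP: vw => /eqP E2.
  - by exists g; [left | rewrite expgS expg1 actM -E1].
  - by move: uw; rewrite -(act_eq g) -E1 -E2 eqxx.
  - by move: uw; rewrite E1 E2 eqxx.
  - exists g^-1; first by right.
    by rewrite expgS expg1 actM E1 actK E2 actK.
case=> uO [g' gg' [-> ->]].
wlog gE : a g g' Ra gg' uO / g' = g.
  move=> WL; case: gg' => gg'; first by apply: (WL a g) => //; left.
  rewrite -orbit_cycle_inv.
  apply: (WL a g^-1 g' (rotary_inv Ra) (or_introl gg') _ gg').
  by rewrite cycleV.
rewrite gE in gg' *; have /rotary_arc2/and3P[uv vw uw] := rotary_shift Ra uO.
rewrite !adj_orbit_cycle (adj_neq uv) (adj_neq vw) uw uO orbit_cycle_actr uO.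
by rewrite expgS expg1 actM !eqxx.
Qed.

(** Any 2-arc of the cycle, in either direction, can serve as its start; this allows two cycles to
    be compared at a common 2-arc. *)
Lemma rotary_rebase a g u v w : rotary a g -> [tuple u; v; w] \in Arc 2 (cyc a g) ->
  exists g', [/\ rotary u g', v = to u g', w = to u (g' ^+ 2)
                & cyc a g = cyc u g'].
Proof.
move=> Ra /(rotary_Arc2 _ _ _ Ra)[uO [g' gg' [-> ->]]]; exists g'.
have Ru := rotary_shift Ra uO.
have E := orbit_cycle_shift uO.
by case: gg' => ->; split; rewrite ?orbit_cycle_inv ?E //; apply: rotary_inv.
Qed.

Lemma rotary_base_Arc2 a g : rotary a g ->
  [tuple a; to a g; to a (g ^+ 2)] \in Arc 2 (cyc a g).
Proof.
move=> Ra; apply/(rotary_Arc2 _ _ _ Ra); split; first exact: orbit_refl.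
by exists g; first by left.
Qed.

Lemma rotary_cycle_ext a g g' : rotary a g -> rotary a g' ->
  to a g = to a g' -> to a (g ^+ 2) = to a (g' ^+ 2) -> cyc a g = cyc a g'.
Proof.
by move=> Ra Ra' e1 e2; apply: orbit_cycle_ext; apply: rotary_ext.
Qed.

(** Once the starting 2-arcs are matched by [x], the image cycle and the target share three points
    and so coincide. *)
Lemma rotary_conj a g b g' : rotary a g -> rotary b g' ->
  exists x, [/\ x \in X, to a x = b & graph_act to (cyc a g) x = cyc b g'].
Proof.
move=> Ra Rb.
have [x [xX ax bx cx]] := arc2_trans (rotary_arc2 Ra) (rotary_arc2 Rb).
exists x; split=> //; rewrite orbit_cycle_act ax.
have := rotary_act xX Ra; rewrite ax => Rx.
apply: rotary_cycle_ext => //; rewrite -ax.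
  by rewrite -actCJ bx ax.
by rewrite act_conjX cx ax.
Qed.

Lemma rotary_length a g b g' : rotary a g -> rotary b g' ->
  #|orb g a| = #|orb g' b|.
Proof.
move=> Ra Rb; have [x [_ _ /(congr1 (@vset T)) /= <-]] := rotary_conj Ra Rb.
by rewrite card_setact.
Qed.

Lemma rotary_length_ge3 a g : rotary a g -> 3 <= #|orb g a|.
Proof.
move=> Ra; have /and3P[ab bc ac] := rotary_arc2 Ra.
have <- : #|[set a; to a g; to a (g ^+ 2)]| = 3.
  by rewrite -setUA cardsU1 !inE negb_or (adj_neq ab) ac cards2 (adj_neq bc).
apply/subset_leq_card/subsetP=> u; rewrite !inE -orbA => /or3P[]/eqP->.
- exact: orbit_refl.
- by rewrite orbit_cycle_actr orbit_refl.
- by apply/orbit_cycleP; exists 2.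
Qed.

Lemma rotary_ncycle a g : rotary a g -> ncycle_of #|orb g a| Sigma (cyc a g).
Proof.
move=> Ra; apply/and3P; split.
- exact: rotary_length_ge3.
- exact: rotary_subgraph.
pose n := #|orb g a|.
have w_inj (i j : 'I_n) : to a (g ^+ i) = to a (g ^+ j) -> i = j.
  by move/(orbit_cycle_injn (ltn_ord i) (ltn_ord j))/val_inj.
have wS (i : 'I_n) : to (to a (g ^+ i)) g = to a (g ^+ ordS i).
  by rewrite -actM -expgSr orbit_cycle_modn.
apply: (@isomorphicI _ _ _ _ (fun i : 'I_n => to a (g ^+ i))).
- by move=> i j _ _; apply: w_inj.
- apply/setP=> u; apply/imsetP/orbit_cycleP => [[i _ ->]|[i ->]].
    by exists i.
  have n_gt0 : 0 < n by apply: leq_trans (rotary_length_ge3 Ra).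
  exists (Ordinal (ltn_pmod i n_gt0)) => //=.
  by rewrite orbit_cycle_modn.
move=> i j _ _; rewrite adj_orbit_cycle adj_graph_of_rel.
rewrite !wS !(inj_eq w_inj); congr (_ && _).
by have -> : to a (g ^+ i) \in orb g a by apply/orbit_cycleP; exists i.
Qed.

Lemma rotary_Arc3 a g : rotary a g -> Arc 3 (cyc a g) \subset D.
Proof.
move=> Ra; apply/subsetP=> t; have [p [q [r [s ->]]]] := tuple4_eta t.
rewrite in_Arc3 ?rotary_simple // => /and5P[pq qr rs pr qs].
have /(rotary_rebase Ra)[g' [Rp qE rE E]] : [tuple p; q; r] \in Arc 2 (cyc a g).
  by rewrite in_Arc2 ?rotary_simple // pq qr.
move: rs; rewrite E adj_orbit_cycle => /and3P[_ _ /orP[]/eqP E1].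
  by have := rotary_D Rp; rewrite -qE -rE (expgSr g' 2) actM -rE -E1.
move: qs; rewrite -(act_eq g') -E1 rE qE expgS expg1 actM eqxx //.
Qed.

(** The induced group is generated by a rotation and a reflection satisfying the dihedral relations,
    hence is an image of the dihedral group; its action on the 2-arcs of the cycle shows that its
    order is at least [2 * n]. *)
Lemma rotary_dihedral a g : rotary a g ->
  induced_group X to (cyc a g) \isog 'D_(2 * #|orb g a|).
Proof.
move=> Ra; set C := cyc a g; set n := #|_|.
pose K := 'C_X[C | graph_action to]%G; pose Kp := 'C_X(vset C | to)%G.
have gX := rotary_X Ra.
have n3 : 3 <= n := rotary_length_ge3 Ra.
have arc_a := rotary_arc2 Ra.
have orb2 : to a (g ^+ 2) \in orb g a by apply/orbit_cycleP; exists 2.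
have Ra2 := rotary_inv (rotary_shift Ra orb2).
have act2 : to a (g ^+ 2) = to (to a g) g by rewrite expgS expg1 actM.
have act2V : to (to a (g ^+ 2)) g^-1 = to a g by rewrite act2 actK.
have act2VV : to (to a (g ^+ 2)) (g^-1 ^+ 2) = a.
  by rewrite expgS expg1 actM act2V actK.
have [h [hX ah gh h2]] : exists h, [/\ h \in X, to a h = to a (g ^+ 2),
    to (to a g) h = to a g & to (to a (g ^+ 2)) h = a].
  by apply: arc2_trans; rewrite // arc2_rev.
(* The image of the walk under [h] and the backward walk from [to a (g ^+ 2)] both follow [D] and
   agree in three points. *)
have hrev i : to (to a (g ^+ i)) h = to (to a (g ^+ 2)) (g^-1 ^+ i).
  pose s i := to (to a (g ^+ i)) h.
  have Ds j : DD (s j) (s j.+1) (s j.+2) (s j.+3) by rewrite D_act ?rotary_walk.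
  apply: (walk_uniq Ds (rotary_walk Ra2)); rewrite /s ?act1 // ?expg1.
    by rewrite gh act2V.
  by rewrite h2 act2VV.
have memKp x : x \in X -> to a x = a -> to (to a g) x = to a g ->
    to (to a (g ^+ 2)) x = to a (g ^+ 2) -> x \in Kp.
  move=> xX x0 x1 x2; apply/setIP; split=> //; apply/astabP=> _ /orbit_cycleP[i ->].
  pose s i := to (to a (g ^+ i)) x.
  have Ds j : DD (s j) (s j.+1) (s j.+2) (s j.+3) by rewrite D_act ?rotary_walk.
  by apply: (walk_uniq Ds (rotary_walk Ra)); rewrite /s ?act1.
have gK : g \in K.
  apply: mem_stab1 => //=; rewrite orbit_cycle_act conjgE mulKg (@orbit_cycle_shift _ _ _ a) //.
  by rewrite orbit_cycle_actr orbit_refl.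
have hK : h \in K.
  apply: mem_stab1 => //=; rewrite orbit_cycle_act ah.
  rewrite (@orbit_cycle_ext _ _ _ _ _ (to a (g ^+ 2)) g^-1).
    by rewrite orbit_cycle_inv (@orbit_cycle_shift _ _ _ a).
  by move=> i; rewrite -{1}ah act_conjX hrev.
have KX x : x \in K -> x \in X by case/setIP.
have nKp : K \subset 'N(Kp).
  apply: normsI; first by apply/normsG/subsetP.
  apply: subset_trans (astab_norm to (vset C)).
  apply/subsetP=> x /setIP[_ /astab1P /(congr1 (@vset T)) E].
  by rewrite -(astab1_set to); apply/astab1P.
have nK x : x \in K -> x \in 'N(Kp) by move/(subsetP nKp).
(* Equalities in [K / Kp] are thereby reduced to three points of the cycle. *)
have coset_eq x y : x \in K -> y \in K -> to a x = to a y ->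
    to (to a g) x = to (to a g) y ->
    to (to a (g ^+ 2)) x = to (to a (g ^+ 2)) y -> coset Kp x = coset Kp y.
  move=> xK yK e0 e1 e2; have xyKp : x * y^-1 \in Kp.
    by apply: memKp; rewrite ?(actM to _ x) ?e0 ?e1 ?e2 ?actK // groupM ?groupV ?KX.
  by rewrite -[x](mulgKV y) (morphM _ (nK _ (groupM xK (groupVr yK))) (nK _ yK))
    /= (coset_id xyKp) mul1g.
have commg i u : to (to u (g ^+ i)) g = to (to u g) (g ^+ i).
  by rewrite -!actM -expgSr expgS.
have commVg i u : to (to u (g ^+ i)) g^-1 = to (to u g^-1) (g ^+ i).
  by apply: (act_inj to g); rewrite actKV commg actKV.
(* An element of [K] sends the starting 2-arc to another 2-arc of the cycle. Modulo [Kp] it is a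
   power of [g] if the image runs forwards, and [h] times a power of [g] if it runs backwards. *)
have genK : <[coset Kp g]> <*> <[coset Kp h]> = K / Kp.
  apply/eqP; rewrite eqEsubset join_subG !cycle_subG !mem_quotient //=.
  apply/subsetP=> _ /morphimP[x _ xK ->].
  suff: coset Kp x \in <[coset Kp g]> <*> <[coset Kp h]> by [].
  have xX := KX x xK; have Rx := rotary_act xX Ra.
  have Ex : cyc (to a x) (g ^ x) = C.
    by rewrite -orbit_cycle_act; case/setIP: xK => _ /astab1P.
  have := rotary_base_Arc2 Rx; rewrite Ex act_conjX -actCJ.
  case/(rotary_Arc2 _ _ _ Ra) => aO [g' [] -> [x1 x2]].
    case/orbit_cycleP: aO => i x0.
    have -> : coset Kp x = coset Kp g ^+ i.
      rewrite -morphX ?nK //; apply: coset_eq; rewrite ?groupX //.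
        by rewrite x1 x0 commg.
      by rewrite x2 x0 !expgS expg0 mulg1 !actM !commg.
    by rewrite groupX // mem_gen // inE cycle_id.
  (* [h] moves [a] to [to a (g ^+ 2)], so the image of [a] under [x] is now reached from that point
     by a power of [g]. *)
  have /orbit_eqP orb2E := orb2; rewrite -orb2E in aO.
  case/orbit_cycleP: aO => i x0.
  have -> : coset Kp x = coset Kp h * coset Kp g ^+ i.
    rewrite -morphX ?nK // -morphM ?nK ?groupX //; apply: coset_eq.
    - by [].
    - by rewrite groupM ?groupX.
    - by rewrite actM ah x0.
    - by rewrite actM gh x1 x0 commVg act2V.
    by rewrite actM h2 x2 x0 expgS expg1 actM !commVg act2V actK.
  by rewrite groupM ?groupX // mem_gen // inE cycle_id ?orbT.
have homD : K / Kp \homg 'D_(2 * n).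
  rewrite mul2n Grp_dihedral ?(ltnW n3) //; apply/existsP.
  exists (coset Kp g, coset Kp h); rewrite /= !xpair_eqE genK eqxx /=.
  apply/and3P; split; apply/eqP.
  - rewrite -morphX ?nK //; apply/coset_id/memKp; rewrite ?groupX //.
    + by rewrite orbit_cycle_period.
    + by rewrite -actM -expgS expgSr actM orbit_cycle_period.
    + by rewrite -actM -expgD addnC expgD actM orbit_cycle_period.
  - have hh u : to u (h ^+ 2) = to (to u h) h by rewrite expgS expg1 actM.
    by rewrite -morphX ?nK //; apply/coset_id/memKp;
      rewrite ?groupX // hh !(ah, gh, h2).
  rewrite -morphJ ?nK // -morphV ?nK //.
  (* The conjugate of [g] by [h] is compared with [g^-1] on the [h]-images of the walk; for [i]
     equal to 2, 1, 0 these images are the three points that [coset_eq] needs. *)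
  have key i : to (to (to a (g ^+ i)) h) (g ^ h) = to (to (to a (g ^+ i)) h) g^-1.
    by rewrite -actCJ -(actM to a (g ^+ i)) -expgSr !hrev (expgSr g^-1) actM.
  apply: coset_eq; rewrite ?groupJ ?groupV //.
  - by have := key 2; rewrite h2.
  - by have := key 1%N; rewrite expg1 gh.
  - by have := key 0; rewrite act1 ah.
rewrite isogEcard homD /= mul2n card_dihedral ?(ltnW n3) //.
rewrite card_quotient //; pose t0 := [tuple a; to a g; to a (g ^+ 2)].
(* With the kernel as stabiliser of [t0] in [K], the index of [Kp] is the size of the [K]-orbit of
   [t0], which contains the [n] forward and the [n] backward 2-arcs of the cycle. *)
have KpE : 'C_K[t0 | tuple_action to 3] = Kp :> {set gT}.
  apply/setP=> x; apply/idP/idP => [|xKp]; last first.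
    have xX : x \in X by case/setIP: xKp.
    have fixO u : u \in orb g a -> to u x = u.
      by case/setIP: xKp => _ /astabP; apply.
    apply: mem_stab1; last by rewrite /= tuple_act3E !fixO ?orbit_cycle_actr ?orbit_refl.
    apply: mem_stab1 => //=; rewrite orbit_cycle_act fixO ?orbit_refl //.
    apply: orbit_cycle_ext => i; rewrite -{1}(fixO a) ?orbit_refl // act_conjX fixO //.
    by apply/orbit_cycleP; exists i.
  case/setIP=> /setIP[xX _] /astab1P; rewrite /= tuple_act3E => /tuple3_eq[x0 x1 x2].
  exact: memKp.
suff: n.*2 <= #|K : Kp| by [].
rewrite -KpE -card_orbit.
pose F x u := [tuple u; to u x; to u (x ^+ 2)].
have F_inj x : injective (F x) by move=> u v /tuple3_eq[].
have F_disj : [disjoint F g @: orb g a & F g^-1 @: orb g a].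
  apply/pred0P=> t /=; apply/negP => /andP[/imsetP[u uO ->] /imsetP[v _]].
  case/tuple3_eq=> <- E _; have := rotary_arc2 (rotary_shift Ra uO).
  case/and3P=> _ _ /eqP; apply.
  by rewrite expgS expg1 actM E actKV.
have F_sub x : x = g \/ x = g^-1 ->
    F x @: orb g a \subset orbit (tuple_action to 3) K t0.
  move=> xg; apply/subsetP=> _ /imsetP[u uO ->].
  have Ru : rotary u x.
    by case: xg => ->; [|apply: rotary_inv]; apply: rotary_shift Ra uO.
  have [y [yX a1 a2 a3]] := arc2_trans arc_a (rotary_arc2 Ru).
  apply/orbitP; exists y; last by rewrite /= tuple_act3E a1 a2 a3.
  apply: mem_stab1 => //=; rewrite orbit_cycle_act a1.
  have -> : cyc u (g ^ y) = cyc u x.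
    apply: rotary_cycle_ext => //; rewrite -a1 ?rotary_act //.
      by rewrite -actCJ a2 a1.
    by rewrite act_conjX a3 a1.
  by case: xg => ->; rewrite ?orbit_cycle_inv (orbit_cycle_shift uO).
have: F g @: orb g a :|: F g^-1 @: orb g a \subset orbit (tuple_action to 3) K t0.
  by rewrite subUset !F_sub //; auto.
move/subset_leq_card; rewrite cardsU disjoint_setI0 // cards0 subn0.
by rewrite (card_imset _ (F_inj g)) (card_imset _ (F_inj g^-1)) addnn.
Qed.

(** * The orbit of cycles and the decomposition of gimel *)

Section CycleOrbit.
Variables (a0 : T) (g0 : gT).
Hypothesis R0 : rotary a0 g0.
Local Notation EE := (orbit (graph_action to) X (cyc a0 g0)).
Local Notation n := #|orb g0 a0|.

Lemma cycle_orbitP C :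
  reflect (exists a g, rotary a g /\ C = cyc a g) (C \in EE).
Proof.
apply: (iffP orbitP) => [[x xX <-]|[a [g [Ra ->]]]].
  by exists (to a0 x), (g0 ^ x); rewrite rotary_act // -orbit_cycle_act.
by have [x [xX _ E]] := rotary_conj R0 Ra; exists x.
Qed.

Lemma cycle_orbit_ncycle : {in EE, forall C, ncycle_of n Sigma C}.
Proof.
move=> _ /cycle_orbitP[a [g [Ra ->]]].
by rewrite (rotary_length R0 Ra); apply: rotary_ncycle.
Qed.

Lemma cycle_orbit_D : D = \bigcup_(C in EE) Arc 3 C.
Proof.
apply/setP=> t; apply/idP/bigcupP => [|[_ /cycle_orbitP[a [g [Ra ->]]]]].
  have [a [b [c [d ->]]]] := tuple4_eta t => Da.
  have [abc bcd] := D_arc2 Da; have [g [Ra ag a2]] := rotary_ex abc.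
  exists (cyc a g); first by apply/cycle_orbitP; exists a, g.
  have := rotary_D Ra; rewrite ag a2 => /(D_uniq Da) dE.
  have := rotary_base_Arc2 Ra; rewrite ag a2 in_Arc2 ?in_Arc3 ?rotary_simple //.
  case/and3P=> -> -> ->; rewrite adj_orbit_cycle.
  case/and3P: bcd => _ /adj_neq-> -> /=; rewrite andbT.
  rewrite dE (expgSr g 2) actM a2 eqxx andbT.
  by apply/orbit_cycleP; exists 2.
by move/subsetP: (rotary_Arc3 Ra); apply.
Qed.

Lemma cycle_orbit_unique a b c : arc2 a b c ->
  exists! C, C \in EE /\ [tuple a; b; c] \in Arc 2 C.
Proof.
move=> abc; have [g [Ra ag a2]] := rotary_ex abc; exists (cyc a g); split.
  split; first by apply/cycle_orbitP; exists a, g.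
  by have := rotary_base_Arc2 Ra; rewrite ag a2.
move=> _ [/cycle_orbitP[u [h [Ru ->]]] /(rotary_rebase Ru)[g' [Ra' bE cE ->]]].
by apply: rotary_cycle_ext; rewrite // ?ag ?a2.
Qed.

(** Chooses a start and a generator for each cycle of the orbit; [(a0, g0)] is the value
    elsewhere. *)
Let base (C : graph T) : T * gT :=
  odflt (a0, g0) [pick w : T * gT | rotary w.1 w.2 && (C == cyc w.1 w.2)].

Let baseP C : C \in EE -> rotary (base C).1 (base C).2 /\ C = cyc (base C).1 (base C).2.
Proof.
case/cycle_orbitP=> a [g [Ra CE]]; rewrite /base.
case: pickP => [w /andP[? /eqP ?] //|/(_ (a, g))]; by rewrite /= Ra CE eqxx.
Qed.

Let step_path g u := pth u (to u g) (to u (g ^+ 2)).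

Let step_adj u g : rotary u g -> adj gim (step_path g u) (step_path g (to u g)).
Proof.
move=> Ru; apply/gimel_adjP.
exists u, (to u g), (to u (g ^+ 2)), (to u (g ^+ 3)); split=> //.
  exact: rotary_D.
by rewrite /step_path -!actM -!expgS.
Qed.

Let step_adjE u g p : rotary u g -> adj gim (step_path g u) p ->
  p = step_path g (to u g) \/ p = step_path g (to u g^-1).
Proof.
move=> Ru /gimel_adjE[d [] [Dd ->]]; [left | right].
  have := rotary_D Ru => /(D_uniq Dd) ->.
  by rewrite /step_path -!actM -!expgS.
(* The extension at the other end comes from the 3-arc that starts one step earlier, read
   backwards. *)
have uO : to u g^-1 \in orb g u by rewrite -(orbit_cycle_actr to u) actKV orbit_refl.
have := rotary_D (rotary_shift Ru uO).
rewrite -!actM mulVg act1 !(expgS _ 2) !(expgS _ 1) expg1 !mulKg -D_rev.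
have -> : g * g = g ^+ 2 by [].
move/(D_uniq Dd) ->.
by rewrite /step_path -!actM mulVg act1 !expgS expg0 mulg1 mulKg path_of3_rev.
Qed.

(** The pair [(i, j)] goes to the 2-path that starts at position [j] of the cycle [i]. Its only
    neighbours are the next and the previous 2-path on the same cycle. *)
Lemma gimel_cycles : isomorphic gim (copies #|EE| (cycle_graph n)).
Proof.
pose m := #|EE|; pose Cy (i : 'I_m) : graph T := enum_val i.
pose pa i := (base (Cy i)).1; pose pg i := (base (Cy i)).2.
have CyE i : Cy i \in EE := enum_valP i.
have Rp i : rotary (pa i) (pg i) by have [] := baseP (CyE i).
have Cp i : Cy i = cyc (pa i) (pg i) by have [] := baseP (CyE i).
have len i : #|orb (pg i) (pa i)| = n by rewrite (rotary_length R0 (Rp i)).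
have n_gt0 : 0 < n by apply: leq_trans (rotary_length_ge3 R0).
pose u_ (i : 'I_m) (j : 'I_n) := to (pa i) (pg i ^+ j).
pose h (w : 'I_m * 'I_n) := step_path (pg w.1) (u_ w.1 w.2).
have uO i j : u_ i j \in orb (pg i) (pa i) by apply/orbit_cycleP; exists j.
have Ru i j : rotary (u_ i j) (pg i) := rotary_shift (Rp i) (uO i j).
have u_inj i j j' : u_ i j = u_ i j' -> j = j'.
  by move/orbit_cycle_injn=> E; apply/val_inj/E; rewrite len.
have modE i k : to (pa i) (pg i ^+ (k %% n)) = to (pa i) (pg i ^+ k).
  by rewrite -(len i) orbit_cycle_modn.
have u_S i j : to (u_ i j) (pg i) = u_ i (ordS j).
  by rewrite /u_ -actM -expgSr /= modE.
have arc_u i j : [tuple u_ i j; to (u_ i j) (pg i); to (u_ i j) (pg i ^+ 2)]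
    \in Arc 2 (Cy i).
  by have := rotary_base_Arc2 (Ru i j); rewrite (orbit_cycle_shift (uO i j)) -Cp.
have sC i : simple_graph (Cy i) by rewrite Cp rotary_simple.
have uniqC a b c i i' : [tuple a; b; c] \in Arc 2 (Cy i) ->
    [tuple a; b; c] \in Arc 2 (Cy i') -> i = i'.
  move=> A1 A2; have abc : arc2 a b c.
    move: A1; rewrite Cp => /(rotary_rebase (Rp i))[g' [Ra -> -> _]].
    exact: rotary_arc2.
  have [C [_ CU]] := cycle_orbit_unique abc.
  by apply/enum_val_inj; rewrite -[LHS]CU // -[RHS]CU.
(* A 2-path, read in either direction, lies on only one cycle, so [i = i']; its middle vertex then
   gives the position. *)
have h_inj : injective h.
  move=> [i j] [i' j'] /path_of3_eq /= [mid E].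
  have ii : i = i'.
    have := arc_u i j; case: E => -[E1 E2]; rewrite E2 mid E1 => /uniqC; apply.
      exact: arc_u.
    have := arc_u i' j'; rewrite !in_Arc2 // => /and3P[A B C].
    by rewrite adj_sym B adj_sym A eq_sym C.
  subst i'; move/act_inj/u_inj: mid => -> //.
pose i0 : 'I_m := enum_rank_in (orbit_refl (graph_action to) X (cyc a0 g0)) (cyc a0 g0).
apply: (@isomorphic_inv _ _ _ _ (i0, Ordinal n_gt0) h).
- by move=> w w' _ _; apply: h_inj.
- apply/setP=> p; apply/imsetP/(Path2P _ Sigma_simple) => [[[i j] _ ->]|].
    exists (u_ i j), (to (u_ i j) (pg i)), (to (u_ i j) (pg i ^+ 2)).
    by split=> //; apply: rotary_arc2.
  case=> a [b [c [abc ->]]].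
  have [C [[CE tC] _]] := cycle_orbit_unique abc.
  pose i : 'I_m := enum_rank_in CE C.
  have iE : Cy i = C by rewrite /Cy enum_rankK_in.
  have idx v : v \in orb (pg i) (pa i) -> exists j, v = u_ i j.
    case/orbit_cycleP=> j ->; exists (Ordinal (ltn_pmod j n_gt0)).
    by rewrite /u_ /= modE.
  move: tC; rewrite -iE Cp => /(rotary_Arc2 _ _ _ (Rp i))[aO [g' gg' [-> ->]]].
  case: gg' => ->.
    have [j ->] := idx _ aO; by exists (i, j); rewrite // !inE.
  (* A 2-path that runs against the generator is indexed by its last vertex instead of its first. *)
  have V2 : to a ((pg i)^-1 ^+ 2) = to (to a (pg i)^-1) (pg i)^-1.
    by rewrite expgS expg1 actM.
  have cO : to a ((pg i)^-1 ^+ 2) \in orb (pg i) (pa i).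
    by rewrite V2 -(orbit_cycle_actr to) actKV -(orbit_cycle_actr to) actKV.
  have [j jE] := idx _ cO; exists (i, j); first by rewrite !inE.
  rewrite /h /= /step_path -jE V2 actKV (expgS _ 1) expg1 actM !actKV.
  by rewrite path_of3_rev.
move=> [i j] [i' j'] _ _; rewrite adj_copies adj_graph_of_rel.
have hS k : h (i, ordS k) = step_path (pg i) (to (u_ i k) (pg i)).
  by rewrite u_S.
apply/idP/and3P => [A|[/eqP <- jj /orP[]/eqP->]].
- have ne := adj_neq A.
  have [E|E] := step_adjE (Ru i j) A.
    move: E; rewrite -hS => /h_inj[ii jj]; subst; rewrite !eqxx; split=> //.
    by apply: contraNneq ne => <-.
  have: h (i', j') = h (i, ord_pred j).
    by rewrite E -{1}(ord_predK j) -u_S actK.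
  move/h_inj=> [ii jj]; subst; rewrite ord_predK !eqxx orbT; split=> //.
  by apply: contraNneq ne => <-.
- by rewrite hS; apply: step_adj.
by rewrite adj_sym hS; apply: step_adj.
Qed.

End CycleOrbit.

(** The fourth neighbour is fixed because it is the only one left. *)
Lemma fix_three_triv x u a b c : x \in X -> uniq [:: a; b; c] ->
  u ~ a -> u ~ b -> u ~ c ->
  to u x = u -> to a x = a -> to b x = b -> to c x = c -> x = 1.
Proof.
move=> xX abc ua ub uc xu xa xb xc.
apply: (fix_nbhd_triv xX (adj_vsetl ua) xu) => v uv.
have [|vs] := boolP (v \in [:: a; b; c]); first by rewrite !inE => /or3P[]/eqP->.
have E : [set w in [:: a; b; c]] = nbhd Sigma u :\ v.
  apply/eqP; rewrite eqEcard (card_nbhdD1 uv) cardsE (card_uniqP _) //= andbT.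
  apply/subsetP=> w; rewrite !inE => w3; apply/andP; split.
    by apply: contraNneq vs => <-; rewrite !inE.
  by case/or3P: w3 => /eqP->.
apply/eqP; apply: contraTT isT => xv.
have: to v x \in nbhd Sigma u :\ v by rewrite !inE xv -xu adj_act.
rewrite -E !inE -{1}xa -{1}xb -{1}xc !act_eq => vs'.
by move: vs; rewrite !inE vs'.
Qed.

(** The right labels are the partners of the left ones under [D], so the relation becomes equality;
    self-pairing makes the partner map bijective. *)
Lemma matching_labels tau sg : tau ~ sg -> exists l r : 'I_3 -> T,
  [/\ injective l, injective r,
      forall u, u \in nbhd Sigma tau :\ sg <-> exists i, u = l i,
      forall u, u \in nbhd Sigma sg :\ tau <-> exists i, u = r i
    & forall i j, DD (l i) tau sg (r j) = (i == j)].
Proof.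
move=> ts; have [l l_inj lP] := enum_set (card_nbhdD1 ts).
have l_arc i : arc2 (l i) tau sg.
  have: l i \in nbhd Sigma tau :\ sg by apply/lP; exists i.
  by rewrite !inE => /andP[-> ]; rewrite adj_sym ts => ->.
pose r i := odflt tau [pick d | DD (l i) tau sg d].
have rD i : DD (l i) tau sg (r i).
  rewrite /r; case: pickP => // no; have [d Dd] := D_ex (l_arc i).
  by rewrite no in Dd.
have lr i j : DD (l i) tau sg (r j) -> i = j.
  have := rD j; rewrite -[DD (l i) _ _ _]D_rev -D_rev => D1 D2.
  exact: l_inj (D_uniq D2 D1).
exists l, r; split=> //.
- by move=> i j E; apply: lr; rewrite -E.
- move=> u; split=> [|[i ->]]; last first.
    by have [_ /and3P[_ sr tr]] := D_arc2 (rD i); rewrite !inE eq_sym tr.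
  rewrite !inE => /andP[ut su].
  have [a Da] : exists a, DD u sg tau a.
    by apply: D_ex; rewrite adj_sym su adj_sym ts.
  have [/and3P[_ _ _] /and3P[_ ta sa]] := D_arc2 Da.
  have [i aE] : exists i, a = l i by apply/lP; rewrite !inE eq_sym sa.
  exists i; rewrite -D_rev aE in Da; exact: D_uniq Da (rD i).
by move=> i j; apply/idP/eqP => [/lr //|<-].
Qed.

(** By uniqueness of extensions, a 2-arc of [xi] amounts to a vertex [s] with an ordered triple
    [s1], [t], [r] of distinct neighbours. The stabiliser of [s] induces all permutations of the
    four neighbours, so X is regular on such data. *)
Lemma Xi_2arc_regular : irregular2 -> arc_regular X toA xi 2.
Proof.
move=> irr.
have Xi2 t t1 s s1 r r1 :
    [tuple [tuple t; t1]; [tuple s; s1]; [tuple r; r1]] \in Arc 2 xi ->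
    [/\ DD t1 t s s1, DD s1 s r r1 & uniq [:: s1; t; r]].
  rewrite in_Arc2 ?Xi_simple // !Xi_adj => /and3P[D1 D2 ne]; split=> //.
  have [/and3P[_ _ t1s] /and3P[_ _ ts1]] := D_arc2 D1.
  have [/and3P[_ _ s1r] _] := D_arc2 D2.
  rewrite /= !inE negb_or s1r eq_sym ts1 !andbT /=.
  apply: contraNneq ne => tr; subst r; rewrite -D_rev in D1.
  by rewrite (D_uniq D1 D2).
have nbrs t t1 s s1 r r1 : DD t1 t s s1 -> DD s1 s r r1 ->
    [/\ s ~ s1, s ~ t & s ~ r].
  move=> /D_arc2[/and3P[_ ts _] /and3P[_ ss1 _]] /D_arc2[/and3P[_ sr _] _].
  by rewrite ss1 sr adj_sym ts.
split; last first.
  move=> w; have [p [q [o ->]]] := tuple3_eta w.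
  have [t [t1 ->]] := tuple2_eta p; have [s [s1 ->]] := tuple2_eta q.
  have [r [r1 ->]] := tuple2_eta o => /Xi2[D1 D2 un].
  have [ss1 st sr] := nbrs _ _ _ _ _ _ D1 D2.
  apply/trivgP/subsetP=> x /setIP[xX /astab1P].
  rewrite [LHS]tuple_act3E /= !tuple_act2E.
  case/tuple3_eq=> /tuple2_eq[xt _] /tuple2_eq[xs xs1] /tuple2_eq[xr _].
  by rewrite (fix_three_triv xX un ss1 st sr xs xs1 xt xr).
have [[a [b [c [d Da]]]] [vtr _]] := (D_neq0, Xi_arc_transitive).
split=> //.
have [abc _] := D_arc2 Da; case/and3P: abc => ab bc ac.
have [e be] := @exists_nbr b [:: a; c] (adj_vsetl bc) isT.
rewrite !inE negb_or => /andP[ea ec].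
have [e1 De] : exists e1, DD a b e e1 by apply: D_ex; rewrite ab be eq_sym.
have w_in : [tuple [tuple c; d]; [tuple b; a]; [tuple e; e1]] \in Arc 2 xi.
  rewrite in_Arc2 ?Xi_simple // !Xi_adj D_rev Da De /=.
  by apply: contraNneq ec => /tuple2_eq[->].
apply: (@atransI _ _ _ _ _ _ w_in) => [w|x w xX].
  have [p [q [o ->]]] := tuple3_eta w.
  have [t [t1 ->]] := tuple2_eta p; have [s [s1 ->]] := tuple2_eta q.
  have [r [r1 ->]] := tuple2_eta o => /Xi2[D1 D2 un].
  have [ss1 st sr] := nbrs _ _ _ _ _ _ D1 D2.
  move: (un); rewrite /= !inE negb_or andbT => /andP[/andP[s1t s1r] tr].
  have s1st : arc2 s1 s t by rewrite adj_sym ss1 st.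
  have abc : arc2 a b c by rewrite ab bc.
  have [x [xX xa xb xc]] := arc2_trans abc s1st.
  (* [x] already places three of the four points. If it misplaces [e], it is corrected by a
     non-trivial [z] fixing [s1], [s] and [t], which must exchange the two remaining neighbours of
     [s]. *)
  have [y [yX ya yb yc ye]] :
      exists y, [/\ y \in X, to a y = s1, to b y = s, to c y = t & to e y = r].
    have [xe|xe] := eqVneq (to e x) r; first by exists x.
    have [z [zX z1 zs1 zs zt]] := irr _ _ _ s1st.
    exists (x * z); rewrite groupM // !actM xa xb xc zs1 zs zt; split=> //.
    have sxe : s ~ to e x by rewrite -xb adj_act.
    have xe_s1 : to e x != s1 by rewrite -xa act_eq.
    have xe_t : to e x != t by rewrite -xc act_eq.
    have ze : to (to e x) z != to e x.
      apply: contraNneq z1 => ze; apply/eqP.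
      apply: (fix_three_triv zX _ ss1 st sxe zs zs1 zt ze).
      by rewrite /= !inE negb_or s1t eq_sym xe_s1 eq_sym xe_t.
    (* The neighbours of [s] other than [r] are listed: [z] fixes two of them and moves the third,
       whose image can therefore only be [r]. *)
    have E : [set s1; t; to e x] = nbhd Sigma s :\ r.
      apply/eqP; rewrite eqEcard (card_nbhdD1 sr); apply/andP; split.
        apply/subsetP=> v; rewrite !inE -orbA => /or3P[]/eqP->; by apply/andP.
      by rewrite -setUA cardsU1 !inE negb_or s1t eq_sym xe_s1 cards2 eq_sym xe_t.
    apply/eqP; apply: contraTT isT => zr.
    have: to (to e x) z \in nbhd Sigma s :\ r by rewrite !inE zr -zs adj_act.
    rewrite -E !inE (negPf ze) orbF -{1}zs1 -{1}zt !act_eq.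
    by rewrite (negPf xe_s1) (negPf xe_t).
  exists y => //; rewrite [LHS]tuple_act3E /= !tuple_act2E ya yb yc ye.
  have Dd : DD s1 s t (to d y) by rewrite -ya -yb -yc D_act.
  have De1 : DD s1 s r (to e1 y) by rewrite -ya -yb -ye D_act.
  by rewrite -D_rev in D1; rewrite (D_uniq Dd D1) (D_uniq De1 D2).
have [p [q [o ->]]] := tuple3_eta w.
have [t [t1 ->]] := tuple2_eta p; have [s [s1 ->]] := tuple2_eta q.
have [r [r1 ->]] := tuple2_eta o.
rewrite [tuple_action _ _ _ _]tuple_act3E /= !tuple_act2E.
rewrite !in_Arc2 ?Xi_simple // !Xi_adj !D_act // => /and3P[-> -> /=].
apply: contraNneq => /tuple2_eq[/act_inj-> /act_inj->] //.
Qed.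

Lemma cycle_data : exists m n (EE : {set graph T}),
  [/\ isomorphic gim (copies m (cycle_graph n)),
      [/\ ncycle_orbit X to Sigma n EE, #|EE| = m, D = \bigcup_(C in EE) Arc 3 C
        & {in EE, forall C, induced_group X to C \isog 'D_(2 * n)}],
      [/\ 6 <= m, girth Sigma <= n, (m * n = 3 * #|eset Sigma|)%N
        & (3 * #|eset Sigma| = 6 * #|V|)%N]
    & isomorphic Sigma (complete 5) \/ near_gonal n Sigma EE].
Proof.
have [a [b [c [d Da]]]] := D_neq0; have [abc _] := D_arc2 Da.
have [g [Ra _ _]] := rotary_ex abc.
pose EE := orbit (graph_action to) X (cyc a g); pose n := #|orb g a|.
have iso := gimel_cycles Ra.
have nC := rotary_ncycle Ra.
have e6 : (3 * #|eset Sigma| = 6 * #|V|)%N.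
  apply/eqP; rewrite -(eqn_pmul2l (isT : 0 < 2)) mulnCA card_eset.
  by rewrite mulnA mulnA.
have mn : (#|EE| * n = 6 * #|V|)%N.
  rewrite -card_Path2; have := isomorphic_card iso.
  by rewrite /= cardsX !cardsT !card_ord => ->.
have nV : n <= #|V|.
  by have /and3P[_ /subset_leq_card] := rotary_subgraph Ra.
have n_gt0 : 0 < n by apply: leq_trans (rotary_length_ge3 Ra).
exists #|EE|, n, EE; split=> //.
- split=> //; first by exists (cyc a g).
    exact: cycle_orbit_D.
  move=> _ /(cycle_orbitP Ra)[u [h [Ru ->]]].
  by rewrite /n (rotary_length Ra Ru); apply: rotary_dihedral.
- split; rewrite ?e6 //; last exact: girth_le nC.
  by rewrite -(leq_pmul2r n_gt0) mn leq_mul.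
case: complete5_or_girth => [?|g4]; [by left | right; split=> //].
  exact: cycle_orbit_ncycle.
move=> t; have [p [q [r ->]]] := tuple3_eta t; rewrite in_Arc2 // => pqr.
exact: cycle_orbit_unique.
Qed.

End Matching.

End ThreeArcs.

Local Notation toA := (tuple_action to 2).
Local Notation toP := ((tuple_action to 3)^*)%act.

(** * The three cases for the number of extensions *)

Section Cases.
Variables (D : {set 4.-tuple T}) (tau sg : T).
Hypothesis D_orbit : self_paired_orbit X to Sigma D.
Hypothesis ts : tau ~ sg.

Local Notation DD a b c d := ([tuple a; b; c; d] \in D).
Local Notation gim := (gimel Sigma D).
Local Notation xi := (Xi Sigma D).
Local Notation P := (Pblock Sigma).
Local Notation A := (Ablock Sigma).
Local Notation X_tau := 'C_X[tau | to].

Lemma case_matching :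
    (forall a b c, arc2 a b c -> #|ext D a b c| = 1%N) ->
  [/\ isomorphic (between gim (P tau) (P sg)) (copies 3 (complete 2)),
      isomorphic (between xi (A tau) (A sg)) (copies 3 (complete 2)),
      has_valency xi 3,
      (exists m n (EE : {set graph T}),
        [/\ isomorphic gim (copies m (cycle_graph n)),
            [/\ ncycle_orbit X to Sigma n EE, #|EE| = m,
                D = \bigcup_(C in EE) Arc 3 C
              & {in EE, forall C, induced_group X to C \isog 'D_(2 * n)}],
            [/\ 6 <= m, girth Sigma <= n, (m * n = 3 * #|eset Sigma|)%N
              & (3 * #|eset Sigma| = 6 * #|V|)%N]
          & isomorphic Sigma (complete 5) \/ near_gonal n Sigma EE])
    & [/\ 'N_X(P tau | toP) = X_tau, 'N_X(A tau | toA) = X_tau,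
          X_tau \isog 'Alt_('I_4),
          arc_regular X toP gim 1 /\ arc_regular X toA xi 1
        & arc_regular X to Sigma 2]
      \/
      [/\ 'N_X(P tau | toP) = X_tau, 'N_X(A tau | toA) = X_tau,
          X_tau \isog 'Sym_('I_4), ~ arc_regular X toP gim 1
        & arc_regular X toA xi 2]].
Proof.
move=> H1; have tV := adj_vsetl ts.
have [l [r [l_inj r_inj lP rP lr]]] := matching_labels D_orbit H1 ts.
have Rl (i : 'I_3) : exists j, i == j by exists i.
have Rr (j : 'I_3) : exists i, i == j by exists j.
split.
- apply: isomorphic_trans (bipartite_matching_copies 3).
  exact: (gimel_between D_orbit ts l_inj r_inj lP rP lr Rl Rr).
- apply: isomorphic_trans (bipartite_matching_copies 3).
  exact: (Xi_between D_orbit ts l_inj r_inj lP rP lr Rl Rr).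
- exact: (Xi_valency D_orbit H1).
- exact: (cycle_data D_orbit H1).
have PE := stab_Pblock tV; have AE := stab_Ablock tV.
have [reg|irr] := regular2_dec D_orbit; [left | right].
  have sreg : semiregular_D D.
    move=> a b c d x Da xX ax bx cx _; have [abc _] := D_arc2 D_orbit Da.
    exact: reg abc xX ax bx cx.
  split=> //; first exact: (stab_Alt D_orbit H1 tV reg).
    split; first exact/(gimel_arc_regular D_orbit).
    exact: (Xi_arc_regular D_orbit).
  split=> // t; have [a [b [c ->]]] := tuple3_eta t; rewrite in_Arc2 // => abc.
  apply/trivgP/subsetP=> x /setIP[xX /astab1P].
  rewrite /= tuple_act3E => /tuple3_eq[ax bx cx].
  by rewrite (reg _ _ _ _ abc xX ax bx cx).
split=> //; first exact: (stab_Sym D_orbit H1 tV irr).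
  move/(gimel_arc_regular D_orbit) => sreg.
  have [a [b [c [d Da]]]] := D_neq0 D_orbit; have [abc _] := D_arc2 D_orbit Da.
  have [x [xX x1 ax bx cx]] := irr _ _ _ abc.
  have dx : to d x = d.
    apply: (D_uniq D_orbit H1) (Da).
    by rewrite -(D_act D_orbit _ _ _ _ xX) ax bx cx in Da.
  by rewrite (sreg _ _ _ _ _ Da xX ax bx cx dx) eqxx in x1.
exact: (Xi_2arc_regular D_orbit H1 irr).
Qed.

(** Exactly one extension of each 2-arc is left over. An element of X taking one 2-arc to another
    preserves the complement, so it must carry the left-over extension along; this gives
    transitivity. *)
Lemma complement_orbit :
    (forall a b c, arc2 a b c -> #|ext D a b c| = 2) ->
  self_paired_orbit X to Sigma (Arc 3 Sigma :\: D) /\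
  (forall a b c, arc2 a b c -> #|ext (Arc 3 Sigma :\: D) a b c| = 1%N).
Proof.
move=> H2; set D' := _ :\: _.
have D'E a b c d : ([tuple a; b; c; d] \in D')
    = ~~ DD a b c d && [&& a ~ b, b ~ c, c ~ d, a != c & b != d].
  by rewrite inE in_Arc3.
have H1 a b c : arc2 a b c -> #|ext D' a b c| = 1%N.
  move=> abc; have -> : ext D' a b c = (nbhd Sigma c :\ b) :\: ext D a b c.
    apply/setP=> d; rewrite in_ext D'E in_setD in_ext in_setD1 in_nbhd.
    case/and3P: abc => -> -> -> /=.
    by rewrite eq_sym [(c ~ d) && _]andbC.
  have sub := ext_sub D_orbit a b c.
  rewrite cardsD (setIidPr sub) H2 // card_nbhdD1 // adj_sym.
  by case/and3P: abc.
split=> //.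
have D'act x a b c d : x \in X ->
    ([tuple to a x; to b x; to c x; to d x] \in D') = ([tuple a; b; c; d] \in D').
  by move=> xX; rewrite !D'E (D_act D_orbit) // !adj_act // !act_eq.
have D'arc a b c d : [tuple a; b; c; d] \in D' -> arc2 a b c.
  by rewrite D'E => /andP[_ /and5P[-> -> _ -> _]].
have [a [b [c [d Da]]]] := D_neq0 D_orbit; have [abc _] := D_arc2 D_orbit Da.
have /eqP/cards1P[e eE] := H1 _ _ _ abc.
have De : [tuple a; b; c; e] \in D' by rewrite -in_ext eE inE.
split.
  apply/imsetP; exists [tuple a; b; c; e]; first by case/setDP: De.
  apply/setP=> t; have [a' [b' [c' [d' ->]]]] := tuple4_eta t.
  apply/idP/orbitP => [De'|[x xX]]; last first.
    by rewrite /= tuple_act4E => <-; rewrite D'act.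
  have abc' := D'arc _ _ _ _ De'.
  have [x [xX ax bx cx]] := arc2_trans abc abc'.
  exists x => //; rewrite /= tuple_act4E ax bx cx; congr [tuple _; _; _; _].
  have /eqP/cards1P[f fE] := H1 _ _ _ abc'.
  have : to e x \in ext D' a' b' c' by rewrite in_ext -ax -bx -cx D'act.
  rewrite fE => /set1P->; apply/esym/set1P.
  by rewrite -fE in_ext.
move=> t; have [p [q [r [s ->]]]] := tuple4_eta t.
rewrite rev_tuple4 !D'E (D_rev D_orbit) => /andP[-> /and5P[A1 A2 A3 A4 A5]].
by rewrite adj_sym A3 adj_sym A2 adj_sym A1 eq_sym A5 eq_sym A4.
Qed.

(** K_{3,3}-3K_2 is a hexagon. Its labels are those of the matching defined by the complement, and
    the cycles are those of the complement too. *)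
Lemma case_hexagon :
    (forall a b c, arc2 a b c -> #|ext D a b c| = 2) ->
  [/\ [/\ isomorphic (between gim (P tau) (P sg))
            (complete_bipartite_minus_matching 3),
          isomorphic (between xi (A tau) (A sg))
            (complete_bipartite_minus_matching 3),
          has_valency gim 4 & has_valency xi 6],
      [/\ 'N_X(P tau | toP) = X_tau, 'N_X(A tau | toA) = X_tau
        & X_tau \isog 'Sym_('I_4)],
      [/\ connected_graph gim, connected_graph xi,
          arc_regular X toP gim 1 & arc_regular X toA xi 1]
    & let D' := Arc 3 Sigma :\: D in
      self_paired_orbit X to Sigma D' /\
      (exists m n (EE : {set graph T}),
        [/\ [/\ ncycle_orbit X to Sigma n EE, #|EE| = m,
                D' = \bigcup_(C in EE) Arc 3 C
              & {in EE, forall C, induced_group X to C \isog 'D_(2 * n)}],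
            [/\ 6 <= m, girth Sigma <= n, 3 <= girth Sigma,
                (m * n = 3 * #|eset Sigma|)%N & (3 * #|eset Sigma| = 6 * #|V|)%N]
          & isomorphic Sigma (complete 5) \/ near_gonal n Sigma EE])].
Proof.
move=> H2; have tV := adj_vsetl ts.
have [D'_orbit H1] := complement_orbit H2; set D' := Arc 3 Sigma :\: D in D'_orbit H1 *.
have [l [r [l_inj r_inj lP rP lr']]] := matching_labels D'_orbit H1 ts.
have lr i j : DD (l i) tau sg (r j) = (i != j).
  have := lr' i j; rewrite inE in_Arc3 // ts.
  have: l i \in nbhd Sigma tau :\ sg by apply/lP; exists i.
  have: r j \in nbhd Sigma sg :\ tau by apply/rP; exists j.
  rewrite !inE => /andP[rt sr] /andP[ls tl].
  rewrite eq_sym in rt; rewrite adj_sym tl sr ls rt !andbT => <-.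
  by rewrite negbK.
have Rl (i : 'I_3) : exists j, i != j.
  by exists (ordS i); case: i => -[|[|[|//]]].
have Rr (j : 'I_3) : exists i, i != j.
  by have [i] := Rl j; exists i; rewrite eq_sym.
(* An element taking one of the two extensions of a 2-arc to the other fixes the 2-arc and is not
   trivial. *)
have irr : irregular2.
  move=> a b c abc; have /eqP/cards2P[d [e [de dE]]] := H2 _ _ _ abc.
  have Dd : DD a b c d by rewrite -in_ext dE !inE eqxx.
  have De : DD a b c e by rewrite -in_ext dE !inE eqxx orbT.
  have [x [xX ax bx cx dx]] := D_trans D_orbit Dd De.
  exists x; split=> //; apply: contraNneq de => x1.
  by rewrite -dx x1 act1.
(* An element fixing a 3-arc of [D] also fixes the left-over extension [e], so it fixes the three
   neighbours [b], [d], [e] of [c]. *)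
have sreg : semiregular_D D.
  move=> a b c d x Da xX ax bx cx dx; have [abc bcd] := D_arc2 D_orbit Da.
  have [e De] := D_ex H1 abc.
  have ex : to e x = e.
    apply: (D_uniq D'_orbit H1) (De).
    by rewrite -(D_act D'_orbit _ _ _ _ xX) ax bx cx in De.
  have [_ /and3P[bc ce be]] := D_arc2 D'_orbit De.
  case/and3P: bcd => _ cd bd; have cb := bc; rewrite adj_sym in cb.
  apply: (fix_three_triv D'_orbit H1 xX _ cb cd ce cx bx dx ex).
  rewrite /= !inE negb_or bd be !andbT /=.
  by apply: contraTneq De => <-; rewrite inE Da.
split.
- split.
  + exact: (gimel_between D_orbit ts l_inj r_inj lP rP lr Rl Rr).
  + exact: (Xi_between D_orbit ts l_inj r_inj lP rP lr Rl Rr).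
  + exact: (gimel_valency D_orbit H2).
  + exact: (Xi_valency D_orbit H2).
- split; [exact: stab_Pblock | exact: stab_Ablock |].
  exact: (stab_Sym D'_orbit H1 tV irr).
- split.
  + exact: (gimel_connected D_orbit H2).
  + exact: (Xi_connected D_orbit H2).
  + exact/(gimel_arc_regular D_orbit).
  + exact: (Xi_arc_regular D_orbit).
split=> //; have [m [n [EE [_ cyc_data [m6 gn mn e6] K5]]]] := cycle_data D'_orbit H1.
exists m, n, EE; split=> //; split=> //.
apply: leq_girth => [|k C /and3P[] //].
have := max_card (mem (nbhd Sigma tau)); rewrite Sigma_val4 //.
by move/(leq_trans (isT : 2 < 4))/leqW.
Qed.

Lemma case_complete :
    (forall a b c, arc2 a b c -> #|ext D a b c| = 3) ->
  [/\ [/\ isomorphic (between gim (P tau) (P sg)) (complete_bipartite 3 3),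
          isomorphic (between xi (A tau) (A sg)) (complete_bipartite 3 3),
          has_valency gim 6 & has_valency xi 9],
      connected_graph gim /\ connected_graph xi,
      one_transitive X toP gim /\ one_transitive X toA xi
    & arc_transitive X to Sigma 3].
Proof.
move=> H3; have DE := D_full D_orbit H3.
have st : sg ~ tau by rewrite adj_sym.
have [l l_inj lP] := enum_set (card_nbhdD1 ts).
have [r r_inj rP] := enum_set (card_nbhdD1 st).
have lr i j : DD (l i) tau sg (r j) = true.
  rewrite DE in_Arc3 // ts.
  have: l i \in nbhd Sigma tau :\ sg by apply/lP; exists i.
  have: r j \in nbhd Sigma sg :\ tau by apply/rP; exists j.
  rewrite !inE => /andP[rt sr] /andP[ls tl].
  by rewrite eq_sym in rt; rewrite adj_sym tl sr ls rt.
have Rt (i : 'I_3) : exists j : 'I_3, true by exists i.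
split.
- split.
  + exact: (gimel_between D_orbit ts l_inj r_inj lP rP lr Rt Rt).
  + exact: (Xi_between D_orbit ts l_inj r_inj lP rP lr Rt Rt).
  + exact: (gimel_valency D_orbit H3).
  + exact: (Xi_valency D_orbit H3).
- split; first exact: (gimel_connected D_orbit H3).
  exact: (Xi_connected D_orbit H3).
- split; split.
  + exact: gimel_arc_transitive.
  + exact: (@gimel_not_2arc_transitive _ D_orbit 3).
  + exact: Xi_arc_transitive.
  + exact: (@Xi_not_2arc_transitive _ D_orbit 3).
exact: (arc3_transitive D_orbit).
Qed.

End Cases.

End TwoArcTransitive.

Theorem theorem6p3 (T : finType) (Sigma : graph T)
    (gT : finGroupType) (X : {group gT}) (to : {action gT &-> T})
    (Sigma_simple : simple_graph Sigma)
    (Sigma_connected : connected_graph Sigma)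
    (Sigma_val4 : has_valency Sigma 4)
    (X_acts : acts_on_graph X to Sigma)
    (X_faithful : [faithful X, on vset Sigma | to])
    (X_2arc : arc_transitive X to Sigma 2) :
  (exists Delta : {set 4.-tuple T}, self_paired_orbit X to Sigma Delta) /\
  (forall (Delta : {set 4.-tuple T}) (tau sigma : T),
    self_paired_orbit X to Sigma Delta ->
    [tuple tau; sigma] \in Arc 1 Sigma ->
    let gim := gimel Sigma Delta in
    let xi := Xi Sigma Delta in
    let toA := tuple_action to 2 in
    let toP := ((tuple_action to 3)^*)%act in
    let e := #|eset Sigma| in
    let mu := #|vset Sigma| in
    let P := Pblock Sigma in
    let A := Ablock Sigma in
    let X_tau := 'C_X[tau | to] in
    let X_P := 'N_X(P tau | toP) in
    let X_A := 'N_X(A tau | toA) in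
    [\/ (* (a) *)
        [/\ isomorphic (between gim (P tau) (P sigma)) (copies 3 (complete 2)),
            isomorphic (between xi (A tau) (A sigma)) (copies 3 (complete 2)),
            has_valency xi 3,
            (exists m n (EE : {set graph T}),
              [/\ isomorphic gim (copies m (cycle_graph n)),
                  [/\ ncycle_orbit X to Sigma n EE, #|EE| = m,
                      Delta = \bigcup_(C in EE) Arc 3 C
                    & {in EE, forall C, induced_group X to C \isog 'D_(2 * n)}],
                  [/\ 6 <= m, girth Sigma <= n, (m * n = 3 * e)%N
                    & (3 * e = 6 * mu)%N]
                & isomorphic Sigma (complete 5) \/ near_gonal n Sigma EE])
          & (* (a.1) *)
            [/\ X_P = X_tau, X_A = X_tau, X_tau \isog 'Alt_('I_4),
                arc_regular X toP gim 1 /\ arc_regular X toA xi 1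
              & arc_regular X to Sigma 2]
            \/ (* (a.2) *)
            [/\ X_P = X_tau, X_A = X_tau, X_tau \isog 'Sym_('I_4),
                ~ arc_regular X toP gim 1
              & arc_regular X toA xi 2]],
        (* (b) *)
        [/\ [/\ isomorphic (between gim (P tau) (P sigma))
                  (complete_bipartite_minus_matching 3),
                isomorphic (between xi (A tau) (A sigma))
                  (complete_bipartite_minus_matching 3),
                has_valency gim 4 & has_valency xi 6],
            [/\ X_P = X_tau, X_A = X_tau & X_tau \isog 'Sym_('I_4)],
            [/\ connected_graph gim, connected_graph xi,
                arc_regular X toP gim 1 & arc_regular X toA xi 1]
          & let Delta' := Arc 3 Sigma :\: Delta in
            self_paired_orbit X to Sigma Delta' /\
            (exists m n (EE : {set graph T}),
              [/\ [/\ ncycle_orbit X to Sigma n EE, #|EE| = m,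
                      Delta' = \bigcup_(C in EE) Arc 3 C
                    & {in EE, forall C, induced_group X to C \isog 'D_(2 * n)}],
                  [/\ 6 <= m, girth Sigma <= n, 3 <= girth Sigma,
                      (m * n = 3 * e)%N & (3 * e = 6 * mu)%N]
                & isomorphic Sigma (complete 5) \/ near_gonal n Sigma EE])]
      | (* (c) *)
        [/\ [/\ isomorphic (between gim (P tau) (P sigma))
                  (complete_bipartite 3 3),
                isomorphic (between xi (A tau) (A sigma))
                  (complete_bipartite 3 3),
                has_valency gim 6 & has_valency xi 9],
            connected_graph gim /\ connected_graph xi,
            one_transitive X toP gim /\ one_transitive X toA xi
          & arc_transitive X to Sigma 3]]).
Proof.
split; first exact: (exists_self_paired_orbit Sigma_simple Sigma_val4 X_acts X_2arc).
move=> Delta tau sigma D_orbit; rewrite in_Arc1 // => ts /=.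
have [k [k_gt0 k_le3 Hk]] := card_ext Sigma_simple Sigma_val4 X_acts X_2arc D_orbit.
case: k k_gt0 k_le3 Hk => [|[|[|[|//]]]] // _ _ Hk.
- by apply: Or31; apply: case_matching.
- by apply: Or32; apply: case_hexagon.
- by apply: Or33; apply: case_complete.
Qed.
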